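(* If $n\in\mathbb{N}^+$ and $X$ is a separable metric space with $\dim_t X\geq n$, then $$\dim_{t^nH}X=\min P_{t^nH}=\min P_{d^nH}=\min P_{p^nH}=\min P_{c^nH}$$ (in particular, all these minima exist).
   Context: $\mathbb{N}=\{0,1,2,\dots\}$ and $\mathbb{N}^+=\{1,2,\dots\}$. $\dim_H$ is Hausdorff dimension, with $\dim_H\emptyset=-1$. $\dim_t$ is the small inductive topological dimension: $\dim_t\emptyset=-1$ and, for non-empty $X$, $\dim_t X=\inf\{d: X \text{ has a basis } \mathcal{U} \text{ such that } \dim_t\partial U\leq d-1 \text{ for every } U\in\mathcal{U}\}$. The $n$th inductive topological Hausdorff dimension: $\dim_{t^nH}\emptyset=-1$ for all $n\in\mathbb{N}$, and for non-empty $X$, $\dim_{t^0H}X=\dim_H X$ and, for $n\geq 1$, $\dim_{t^nH}X=\inf\{d: X\text{ has a basis }\mathcal{U}\text{ such that }\dim_{t^{n-1}H}\partial U\leq d-1\text{ for every }U\in\mathcal{U}\}$. All these dimensions may be $\infty$ (so $d=\infty$ is allowed in the infima), with $\infty-c=\infty$ for finite $c$. For $s\geq 0$, $\mathcal{H}^s_\infty(A)=\inf\{\sum_{i=1}^\infty(\operatorname{diam}U_i)^s: A\subseteq\bigcup_{i=1}^\infty U_i\}$ is the $s$-Hausdorff content ($\operatorname{diam}\emptyset=0$). For a family of sets $\mathcal{A}$ (repeated copies of members allowed) and $m\in\mathbb{N}^+$, $T_m(\mathcal{A})$ is the set of points covered by at least $m$ members of $\mathcal{A}$. A refinement of a cover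 $\mathcal{U}$ of $X$ is a cover $\mathcal{V}$ of $X$ such that each member of $\mathcal{V}$ is contained in some member of $\mathcal{U}$; it is open if its members are open. A partition between disjoint sets $A,B\subseteq X$ is a set $L\subseteq X$ of the form $L=X\setminus(U\cup V)$ with $U,V$ open, $A\subseteq U$, $B\subseteq V$, $U\cap V=\emptyset$. For the given $X$ and $n$, the following are sets of extended real numbers $d$: $P_{t^nH}=\{d: X\text{ has a basis }\mathcal{U}\text{ such that }\dim_{t^{n-1}H}\partial U\leq d-1\text{ for every }U\in\mathcal{U}\}$; $P_{d^nH}=\{d\geq n:\exists A\subseteq X\text{ such that }\dim_H A\leq d-n\text{ and }\dim_t(X\setminus A)\leq n-1\}$; $P_{p^nH}=\{d\geq n:$ for all pairs $(A_1,B_1),\dots,(A_n,B_n)$ of disjoint closed subsets of $X$ there exist partitions $L_i$ between $A_i$ and $B_i$ such that $\dim_H(\bigcap_{i=1}^n L_i)\leq d-n\}$; $P_{c^nH}=\{d\geq n:$ for every $\varepsilon>0$ and every finite open cover $\mathcal{U}$ of $X$ there is a finite open refinement $\mathcal{V}$ of $\mathcal{U}$ such that $\mathcal{H}^{d-n+\varepsilon}_\infty(T_{n+1}(\mathcal{V}))\leq\varepsilon\}$; by convention $\infty$ belongs to all four sets. (In each pair $(A_i,B_i)$ the sets $A_i$ and $B_i$ are disjoint from each other.) *)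

(* Defs.v *)
(** Topological and fractal dimensions of the subsets of a metric space [X].

    A subspace of [X] is a subset [A : set X], and all the notions attached to
    the space [A] (open sets, bases, boundaries) are relative to [A]; the space
    [X] itself is [[set: X]].  Dimensions are elements of [\bar R].  In [\bar R],
    [+oo - c = +oo] for finite [c], and the infimum of the empty set is [+oo]. *)
From HB Require Import structures.
From mathcomp Require Import all_boot all_order all_algebra.
From mathcomp Require Import all_classical all_reals all_analysis.

Set Implicit Arguments.
Unset Strict Implicit.
Unset Printing Implicit Defensive.

Import Order.TTheory GRing.Theory Num.Theory.

Local Open Scope classical_set_scope.
Local Open Scope ring_scope.
Local Open Scope ereal_scope.

Section Subspaces.
Context {X : topologicalType}.
Implicit Types A B U L : set X.

Definition separable := exists2 D : set X, countable D & dense D.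

Definition open_in A U := exists2 W : set X, open W & U = A `&` W.

Definition basis_of A (BB : set (set X)) :=
  (forall U, BB U -> open_in A U) /\
  (forall (x : X) (W : set X), A x -> open W -> W x ->
     exists U, [/\ BB U, U x & U `<=` W]).

(* For [U `<=` A]: the closure in [A] of a subset [S] of [A] is
   [A `&` closure S]. *)
Definition boundary_in A U := A `&` closure U `&` closure (A `\` U).

Definition partition_between A B L :=
  exists U V : set X, [/\ open U /\ open V, A `<=` U, B `<=` V,
                          U `&` V = set0 & L = ~` (U `|` V)].

Definition open_cover k (U : 'I_k -> set X) :=
  (forall i, open (U i)) /\ cover [set: 'I_k] U = [set: X].

Definition refines k l (V : 'I_l -> set X) (U : 'I_k -> set X) :=
  forall j, exists i, V j `<=` U i.

(* Points are counted with the multiplicity of the indexed family [V]. *)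
Definition covered_at_least (m : nat) k (V : 'I_k -> set X) : set X :=
  [set x | (m <= #|[pred i : 'I_k | x \in V i]|)%N].

End Subspaces.
Arguments separable X : clear implicits.

Section Dimensions.
Context {R : realType}.

Section TopologicalDimension.
Context {X : topologicalType}.
Implicit Types A : set X.

(* [tdim_lt k A] means [dim_t A <= k - 1]: the recursion bottoms out at
   dimension -1. *)
Fixpoint tdim_lt (k : nat) A : Prop :=
  if k is j.+1 then
    exists2 BB, basis_of A BB & forall U, BB U -> tdim_lt j (boundary_in A U)
  else A = set0.

Definition tdim A : \bar R :=
  ereal_inf [set (k%:R - 1)%:E | k in [set k | tdim_lt k A]].

End TopologicalDimension.

Section HausdorffDimension.
Context {X : metricType R}.
Implicit Types A U : set X.

(* Adjoining 0 only matters for [U = set0], whose diameter is 0. *)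
Definition diam U : \bar R :=
  ereal_sup (0 |` [set (mdist p.1 p.2)%:E | p in U `*` U]).

(* The convention at exponent 0 is [(diam set0)^0 = 0], and [0^0 = 1] for
   singletons, so that the 0-dimensional Hausdorff measure counts points. *)
Definition diam_pow (s : R) U : \bar R :=
  if `[< U = set0 >] then 0 else poweR (diam U) s.

Definition hausdorff_premeasure (delta : \bar R) (s : R) A : \bar R :=
  ereal_inf [set \sum_(0 <= i <oo) diam_pow s (U i) | U in
    [set U : nat -> set X |
       A `<=` \bigcup_i U i /\ forall i, diam (U i) <= delta]].

Definition hausdorff_content (s : R) A := hausdorff_premeasure +oo s A.

Definition hausdorff_measure (s : R) A : \bar R :=
  ereal_sup [set hausdorff_premeasure delta%:E s A |
              delta in [set delta : R | (0 < delta)%R]].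

Definition hdim A : \bar R :=
  if `[< A = set0 >] then -1
  else ereal_inf [set s%:E | s in
         [set s : R | (0 <= s)%R /\ hausdorff_measure s A = 0]].

Fixpoint thdim (n : nat) A : \bar R :=
  if `[< A = set0 >] then -1 else
  if n is m.+1 then
    ereal_inf [set d : \bar R | exists2 BB, basis_of A BB &
                 forall U, BB U -> thdim m (boundary_in A U) <= d - 1]
  else hdim A.

End HausdorffDimension.

Section CharacterizingSets.
Variables (X : metricType R) (n : nat).

(* Only meaningful for [0 < n]. *)
Definition P_t : set (\bar R) :=
  [set d | d = +oo \/
    exists2 BB, basis_of [set: X] BB &
      forall U, BB U -> thdim n.-1 (boundary_in [set: X] U) <= d - 1].

Definition P_d : set (\bar R) :=
  [set d | d = +oo \/
    n%:R%:E <= d /\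
    exists A : set X, hdim A <= d - n%:R%:E /\ tdim (~` A) <= n%:R%:E - 1].

Definition P_p : set (\bar R) :=
  [set d | d = +oo \/
    n%:R%:E <= d /\
    forall A B : 'I_n -> set X,
      (forall i, [/\ closed (A i), closed (B i) & A i `&` B i = set0]) ->
      exists L : 'I_n -> set X,
        (forall i, partition_between (A i) (B i) (L i)) /\
        hdim (\bigcap_i L i) <= d - n%:R%:E].

Definition P_c : set (\bar R) :=
  [set d | d = +oo \/
    exists r : R, [/\ d = r%:E, (n%:R <= r)%R &
      forall (eps : R) k (U : 'I_k -> set X), (0 < eps)%R -> open_cover U ->
        exists l (V : 'I_l -> set X),
          [/\ open_cover V, refines V U &
              hausdorff_content (r - n%:R + eps)
                (covered_at_least n.+1 V) <= eps%:E]]].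

End CharacterizingSets.

Definition is_minimum (P : set (\bar R)) (m : \bar R) := P m /\ lbound P m.

End Dimensions.

(* [tdim] satisfies the recursive definition of the small inductive
   dimension. *)
Section TdimRecursion.
Context {R : realType} {X : topologicalType}.
Implicit Types A : set X.

Lemma tdim_lt_set0 k : tdim_lt k (set0 : set X).
Proof. by case: k => //= k; exists set0 => //; split. Qed.

Lemma tdim_ltS k A : tdim_lt k A -> tdim_lt k.+1 A.
Proof.
elim: k A => [A ->|k IH A [BB bBB BBk]]; first exact: tdim_lt_set0.
by exists BB => // U /BBk /IH.
Qed.

Lemma tdim_lt_leq k l A : (k <= l)%N -> tdim_lt k A -> tdim_lt l A.
Proof.
move=> /subnKC <-; elim: (l - k)%N => [|m IH]; first by rewrite addn0.
by move=> /IH; rewrite addnS; exact: tdim_ltS.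
Qed.

Lemma tdim_geN1 A : -1 <= tdim (R := R) A.
Proof.
apply: le_ereal_inf_tmp => _ [k _ <-].
by rewrite EFinB leeDr// lee_fin.
Qed.

Lemma tdim_set0 : tdim (R := R) (set0 : set X) = -1.
Proof.
apply/eqP; rewrite eq_le tdim_geN1 andbT.
by apply: ereal_inf_lbound; exists 0%N => //; rewrite sub0r.
Qed.

Lemma tdimE A : A !=set0 ->
  tdim (R := R) A =
  ereal_inf [set d : \bar R | exists2 BB, basis_of A BB &
               forall U, BB U -> tdim (boundary_in A U) <= d - 1].
Proof.
move=> [a Aa]; apply/eqP; rewrite eq_le; apply/andP; split.
- apply: le_ereal_inf_tmp => d [BB bBB BBd].
  have d0 : 0 <= d.
    have [U [/BBd Ud _ _]] := bBB.2 a setT Aa (@openT X) Logic.I.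
    have := le_trans (tdim_geN1 _) Ud.
    by rewrite leeBrDr// -EFinD addNr.
  case: d d0 BBd => [r r0 BBr | _ _ | //]; last by rewrite leey.
  rewrite lee_fin in r0; have /andP[jr rj] := truncn_itv r0.
  apply: (@le_trans _ _ (Num.truncn r)%:R%:E); last by rewrite lee_fin.
  apply: ereal_inf_lbound; exists (Num.truncn r).+1; last by rewrite -natr1 addrK.
  exists BB => // U /BBr Ur.
  have : tdim (R := R) (boundary_in A U) < (Num.truncn r)%:R%:E.
    by apply: le_lt_trans Ur _; rewrite -EFinB lte_fin ltrBlDr natr1.
  move=> /ereal_inf_lt[_ [k /= kU <-]].
  rewrite lte_fin ltrBlDr natr1 ltr_nat ltnS => kj.
  exact: tdim_lt_leq kj kU.
- apply: le_ereal_inf_tmp => _ [[/= A0|k [BB bBB BBk]] <-].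
    by rewrite A0 in Aa.
  apply: ereal_inf_lbound; exists BB => // U /BBk Uk.
  by apply: ereal_inf_lbound; exists k => //; rewrite -natr1 addrK.
Qed.

End TdimRecursion.

(* Main.v *)
(** Everything is reduced, for [d = s + n] with [s] real, to one condition on
    [n]-fold partitions: for each [e > 0], any [n] pairs of disjoint closed sets
    have partitions whose intersection lies in an open set of [s + e]-content at
    most [e] ([small_partitions]).  It is visibly closed in [s], which is why the
    minima exist.

    Towards it.  A bound on either inductive dimension decomposes the space into
    a negligible part and [n] zero-dimensional sets, by removing the boundaries
    of a countable base and applying the countable sum theorem for
    zero-dimensional sets; then the [i]-th partition is chosen to miss the
    [i]-th zero-dimensional set.  A finite open cover with small [T_(n+1)]
    yields level sets of sums of bump functions; at generic levels they do not
    meet at points covered at most [n] times, since there [n] bumps would have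
    to satisfy [n + 1] independent linear equations.

    Away from it.  Thickening partitions a little at each of countably many
    steps, one finds for any sequence of pairs a sequence of partitions such
    that any [n] of them meet in a set of Hausdorff dimension at most [s].  Apply
    this to a sequence containing each pair of a countable base infinitely often:
    the partitions bound a base witnessing [P_t], and the points on at least [n]
    of them form the set [A] of [P_d]. *)
From mathcomp Require Import all_boot all_order all_algebra.
From mathcomp Require Import all_classical all_reals all_analysis.
From mathcomp Require Import lra ring.
(* Last, because [vector] also exports a [basis_of]. *)
Require Import Defs.

Set Implicit Arguments.
Unset Strict Implicit.
Unset Printing Implicit Defensive.

Import Order.TTheory GRing.Theory Num.Theory.
Import numFieldNormedType.Exports.

Local Open Scope classical_set_scope.
Local Open Scope ring_scope.

(** * Distance to a set and separation in metric spaces *)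

Lemma disjointP (T : Type) (A B : set T) :
  A `&` B = set0 <-> forall x, A x -> B x -> False.
Proof.
split=> [AB x Ax Bx|AB]; first by have : (A `&` B) x by []; rewrite AB.
by apply/seteqP; split=> // x [/AB].
Qed.

Section MetricSeparation.
Context {R : realType} {X : metricType R}.
Implicit Types A B F P Q U V Z : set X.

(* The distance truncated at 1, so that it is also meaningful for [F = set0]. *)
Definition tdist F (x : X) : R := inf (1 |` [set mdist x a | a in F]).

Lemma tdist_lb F (x : X) : lbound (1 |` [set mdist x a | a in F]) 0.
Proof. by move=> _ [->|[a _ <-]]; [exact: ler01|exact: mdist_ge0]. Qed.

Lemma tdist_ge0 F x : 0 <= tdist F x.
Proof. by apply: lb_le_inf; [exists 1; left|exact: tdist_lb]. Qed.

Lemma tdist_le F x a : F a -> tdist F x <= mdist x a.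
Proof.
move=> Fa; apply: ge_inf; first by exists 0; exact: tdist_lb.
by right; exists a.
Qed.

Lemma tdist_le1 F x : tdist F x <= 1.
Proof. by apply: ge_inf; [exists 0; exact: tdist_lb|left]. Qed.

Lemma tdist_lip F x y : tdist F x <= mdist x y + tdist F y.
Proof.
rewrite -lerBlDl; apply: lb_le_inf; first by exists 1; left.
move=> _ [->|[a Fa <-]]; rewrite lerBlDl.
  by rewrite (le_trans (tdist_le1 _ _))// lerDr mdist_ge0.
exact: (le_trans (tdist_le _ Fa)) (metric_triangle _ _ _).
Qed.

Lemma nbhs_mdist (x : X) (e : R) : 0 < e -> \forall y \near x, mdist x y < e.
Proof. by move=> e0; have := nbhsx_ballx x e e0; rewrite ballEmdist. Qed.

Lemma nbhs_mdistP (x : X) A : nbhs x A ->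
  exists2 e : R, 0 < e & forall y, mdist x y < e -> A y.
Proof. by move=> /nbhs_ballP[e /= e0]; rewrite ballEmdist => xA; exists e. Qed.

Lemma open_mdist_lt (x : X) (e : R) : open [set y | mdist x y < e].
Proof.
rewrite openE => y /= xy.
have d0 : 0 < e - mdist x y by rewrite subr_gt0.
apply: filterS (nbhs_mdist y d0) => z yz /=.
by apply: le_lt_trans (metric_triangle x y z) _; rewrite -ltrBrDl.
Qed.

Lemma tdist_continuous F : continuous (tdist F).
Proof.
move=> x; apply/cvgrPdist_lt => e e0; near=> y.
have xy : mdist x y < e by near: y; exact: nbhs_mdist.
rewrite ltr_norml; apply/andP; split.
  rewrite ltrBrDr addrC ltrBlDr (le_lt_trans (tdist_lip _ _ x))//.
  by rewrite metric_sym addrC ltrD2l.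
by rewrite ltrBlDr (le_lt_trans (tdist_lip _ _ y))// ltrD2r.
Unshelve. all: by end_near. Qed.

Lemma closure_sub_closed A B : closed B -> A `<=` B -> closure A `<=` B.
Proof. by move=> /closure_id {2}->; exact: closureS. Qed.

Lemma tdist_eq0 F x : (tdist F x = 0) <-> closure F x.
Proof.
split=> [d0 B /nbhs_mdistP[e e0 eB]|clF].
  have : tdist F x < Num.min e 1 by rewrite d0 lt_min e0 ltr01.
  move=> /inf_lt[]; first by exists 1; left.
  move=> _ [->|[a Fa <-]]; rewrite lt_min ?ltxx ?andbF// => /andP[xa _].
  by exists a; split=> //; exact: eB.
apply/eqP; rewrite eq_le tdist_ge0 andbT; apply/ler_addgt0Pl => e e0.
have [a [Fa /= xa]] := clF _ (nbhs_mdist x e0).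
by rewrite addr0 (le_trans (tdist_le _ Fa))// ltW.
Qed.

Lemma tdist_gt0 F x : closed F -> (0 < tdist F x) <-> ~ F x.
Proof.
move=> /closure_id cF; rewrite lt0r tdist_ge0 andbT; split.
  by move=> /eqP d0 Fx; apply: d0; apply/tdist_eq0; rewrite -cF.
by move=> nF; apply/eqP => /tdist_eq0; rewrite -cF.
Qed.

Lemma continuous_open_lt (f g : X -> R) : continuous f -> continuous g ->
  open [set x | f x < g x].
Proof.
move=> cf cg; rewrite (_ : [set _ | _] = (g \- f) @^-1` [set t | 0 < t]).
  apply: open_comp; last exact: open_gt.
  by move=> x _; apply: continuousB; [exact: cg|exact: cf].
by apply/seteqP; split=> x /=; rewrite subr_gt0.
Qed.

Lemma continuous_closed_le (f g : X -> R) : continuous f -> continuous g ->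
  closed [set x | f x <= g x].
Proof.
move=> cf cg; rewrite (_ : [set _ | _] = ~` [set x | g x < f x]).
  by apply: open_closedC; exact: continuous_open_lt.
by apply/seteqP; split=> x /=; rewrite leNgt => /negP.
Qed.

(** The points strictly nearer to [A] than to [B], and conversely. *)
Lemma separated_open A B :
  A `&` closure B = set0 -> closure A `&` B = set0 ->
  exists U V, [/\ open U, open V, A `<=` U, B `<=` V & U `&` V = set0].
Proof.
move=> AB BA.
exists [set x | tdist A x < tdist B x], [set x | tdist B x < tdist A x].
split.
- by apply: continuous_open_lt; exact: tdist_continuous.
- by apply: continuous_open_lt; exact: tdist_continuous.
- move=> x Ax /=; have /tdist_eq0 -> : closure A x by exact: subset_closure.
  rewrite lt0r tdist_ge0 andbT; apply/eqP => /tdist_eq0 Bx.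
  by have : (A `&` closure B) x by []; rewrite AB.
- move=> x Bx /=; have /tdist_eq0 -> : closure B x by exact: subset_closure.
  rewrite lt0r tdist_ge0 andbT; apply/eqP => /tdist_eq0 Ax.
  by have : (closure A `&` B) x by []; rewrite BA.
- by apply/seteqP; split=> x //= [/ltW]; rewrite leNgt => /negP.
Qed.

(* No disjointness is assumed: the closures only meet inside [P `&` Q]. *)
Lemma closed_open_nbhd P Q : closed P -> closed Q ->
  exists U V, [/\ open U, open V, P `\` Q `<=` U, Q `\` P `<=` V &
                  closure U `&` closure V `<=` P `&` Q].
Proof.
move=> cP cQ; pose p := tdist P; pose q := tdist Q.
have cp : continuous p by exact: tdist_continuous.
have cq : continuous q by exact: tdist_continuous.
have c2 f : continuous f -> continuous (fun x : X => f x + f x : R).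
  by move=> cf x; apply: continuousD; exact: cf.
(* The factor 2 survives passage to closures: [2p <= q] and [2q <= p] together force [p = q = 0]. *)
exists [set x | p x + p x < q x], [set x | q x + q x < p x]; split.
- by apply: continuous_open_lt => //; exact: c2.
- by apply: continuous_open_lt => //; exact: c2.
- move=> x [Px nQx] /=.
  rewrite /p (_ : tdist P x = 0) ?addr0; last by apply/tdist_eq0; exact: subset_closure.
  exact/tdist_gt0.
- move=> x [Qx nPx] /=.
  rewrite /q (_ : tdist Q x = 0) ?addr0; last by apply/tdist_eq0; exact: subset_closure.
  exact/tdist_gt0.
- move=> x [xU xV].
  have clle (f g : X -> R) : continuous f -> continuous g ->
      closure [set x | f x + f x < g x] `<=` [set x | f x + f x <= g x].
    move=> cf cg; apply: closure_sub_closed; last by move=> y /= /ltW.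
    by apply: continuous_closed_le => //; exact: c2.
  have /= h1 := clle _ _ cp cq _ xU.
  have /= h2 := clle _ _ cq cp _ xV.
  have p0 := tdist_ge0 P x; have q0 := tdist_ge0 Q x; rewrite -/(p x) -/(q x) in p0 q0.
  have p0' : p x = 0 by apply/eqP; rewrite eq_le p0 andbT; lra.
  have q0' : q x = 0 by apply/eqP; rewrite eq_le q0 andbT; lra.
  split; first by rewrite (proj1 (closure_id _) cP); apply/tdist_eq0.
  by rewrite (proj1 (closure_id _) cQ); apply/tdist_eq0.
Qed.

End MetricSeparation.

(** * Zero-dimensional sets *)

Lemma dep_choice (T : Type) (I : T -> Prop) (S : nat -> T -> T -> Prop) t0 :
  I t0 -> (forall k t, I t -> exists2 t', I t' & S k t t') ->
  exists2 f : nat -> T, f 0%N = t0 & forall k, I (f k) /\ S k (f k) (f k.+1).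
Proof.
move=> It0 IS.
have /choice[g gP] : forall p : nat * T, exists t', I p.2 -> I t' /\ S p.1 p.2 t'.
  move=> [k t]; have [It|nI] := pselect (I t); last by exists t.
  by have [t' It' Stt'] := IS k t It; exists t'.
pose f := fix f k := if k is j.+1 then g (j, f j) else t0.
have If k : I (f k) by elim: k => //= k /(gP (k, f k))[].
by exists f => // k; split=> //; have [] := gP (k, f k) (If k).
Qed.

Section ZeroDimensional.
Context {R : realType} {X : metricType R}.
Implicit Types A B F P Q U V Z : set X.

Lemma notin_closure A U x : open U -> U x -> U `<=` ~` A -> ~ closure A x.
Proof.
by move=> oU Ux UA /(_ U (open_nbhs_nbhs (conj oU Ux)))[y [Ay /UA]].
Qed.

(** Closed sets with disjoint traces on [Z] are separated by a relatively clopen partition of [Z].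
    The open sets [U] and [V] live in the whole space and may meet outside [Z]. *)
Definition rel_sep Z := forall P Q, closed P -> closed Q -> P `&` Q `<=` ~` Z ->
  exists U V, [/\ open U, open V, Z `&` P `<=` U, Z `&` Q `<=` V &
                  Z `<=` U `|` V /\ U `&` V `<=` ~` Z].

(* All subsets, since [rel_sep] is not obviously hereditary: [P] and [Q] may
   meet inside [Z] but outside [Z']. *)
Definition zdim Z := forall Z', Z' `<=` Z -> rel_sep Z'.

Lemma zdimS Z Z' : Z' `<=` Z -> zdim Z -> zdim Z'.
Proof. by move=> ZZ' zZ Z'' /subset_trans/(_ ZZ')/zZ. Qed.

(** Neither of the traces of [U] and [V] on [Z] meets the closure of the other, so [separated_open]
    applies. *)
Lemma rel_sep_open Z U V : U `&` V `<=` ~` Z -> open U -> open V ->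
  exists O G', [/\ open O, open G', Z `&` U `<=` O, Z `&` V `<=` G' & O `&` G' = set0].
Proof.
move=> UVZ oU oV; apply: separated_open; apply/seteqP; split=> // x /=.
- move=> [[Zx Ux]]; apply: notin_closure oU Ux _ => y Uy [Zy Vy]; exact: (UVZ y).
- move=> [+ [Zx Vx]]; apply: notin_closure oV Vx _ => y Vy [Zy Uy]; exact: (UVZ y).
Qed.

(** [Z] is split between neighbourhoods of [A] and [B] with disjoint closures, so no piece of it
    accumulates at the wrong closed set; [A] with one piece is then separated from [B] with the
    other. *)
Lemma rel_sep_partition Z A B : rel_sep Z ->
  closed A -> closed B -> A `&` B = set0 ->
  exists2 L, partition_between A B L & L `<=` ~` Z.
Proof.
move=> sZ cA cB AB0.
have [U0 [V0 [oU0 oV0 AU0 BV0 UV0]]] := closed_open_nbhd cA cB.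
have {}AU0 : A `<=` U0.
  by move=> x Ax; apply: AU0; split=> // Bx; rewrite -[False]/(set0 x) -AB0.
have {}BV0 : B `<=` V0.
  by move=> x Bx; apply: BV0; split=> // Ax; rewrite -[False]/(set0 x) -AB0.
have [|U [V [oU oV PU QV [ZUV UVZ]]]] :=
    sZ (closure U0) (closure V0) (@closed_closure _ _) (@closed_closure _ _).
  by move=> x /UV0; rewrite AB0.
have [G [G' [oG oG' AG BG GG']]] :
    exists G G', [/\ open G, open G', A `|` (Z `&` U) `<=` G,
                     B `|` (Z `&` V) `<=` G' & G `&` G' = set0].
  have /closure_id eA := cA; have /closure_id eB := cB.
  apply: separated_open; rewrite closureU -?eA -?eB; apply/seteqP; split=> // x /=.
  - move=> [[Ax|[Zx Ux]] [Bx|]].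
    + by rewrite -[False]/(set0 x) -AB0.
    + apply: notin_closure oU0 (AU0 _ Ax) _ => y Uy [Zy Vy].
      by apply: (UVZ y) => //; split=> //; apply: PU; split=> //; exact: subset_closure.
    + apply: (UVZ x) => //; split=> //; apply: QV; split=> //.
      exact/subset_closure/BV0.
    + apply: notin_closure oU Ux _ => y Uy [Zy Vy]; exact: (UVZ y).
  - move=> [+ [Bx|[Zx Vx]]] => -[Ax|].
    + by rewrite -[False]/(set0 x) -AB0.
    + apply: notin_closure oV0 (BV0 _ Bx) _ => y Vy [Zy Uy].
      by apply: (UVZ y) => //; split=> //; apply: QV; split=> //; exact: subset_closure.
    + apply: (UVZ x) => //; split=> //; apply: PU; split=> //.
      exact/subset_closure/AU0.
    + apply: notin_closure oV Vx _ => y Vy [Zy Uy]; exact: (UVZ y).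
exists (~` (G `|` G')).
  by exists G, G'; split=> // x ?; [apply: AG|apply: BG]; left.
move=> x nG Zx; apply: nG; have [Ux|Vx] := ZUV _ Zx.
  by left; apply: AG; right.
by right; apply: BG; right.
Qed.

(** Countable sum theorem: two open sets around the traces of [P] and [Q] grow, step [k] absorbing
    the part of [Z] in [F k]. Keeping their closures disjoint on [Z] lets the construction
    continue. *)
Lemma rel_sep_bigcup Z (F : nat -> set X) : (forall k, closed (F k)) ->
  (forall k, rel_sep (Z `&` F k)) -> Z `<=` \bigcup_k F k -> rel_sep Z.
Proof.
move=> cF sF ZF P Q cP cQ PQZ.
pose I (p : set X * set X) :=
  [/\ open p.1, open p.2 & closure p.1 `&` closure p.2 `<=` ~` Z].
pose S k (p q : set X * set X) :=
  [/\ Z `&` p.1 `<=` q.1, Z `&` p.2 `<=` q.2 & Z `&` F k `<=` q.1 `|` q.2].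
have [U0 [V0 [oU0 oV0 PU QV UV0]]] := closed_open_nbhd cP cQ.
have ZPU : Z `&` P `<=` U0.
  by move=> x [Zx Px]; apply: PU; split=> // Qx; exact: (PQZ x).
have ZQV : Z `&` Q `<=` V0.
  by move=> x [Zx Qx]; apply: QV; split=> // Px; exact: (PQZ x).
have I0 : I (U0, V0) by split=> // x /UV0 /PQZ.
have step k p : I p -> exists2 q, I q & S k p q.
  case: p => U V [/= oU oV UVZ].
  have [|U' [V' [oU' oV' PU' QV' [ZUV' UVZ']]]] :=
      sF k _ _ (@closed_closure _ U) (@closed_closure _ V).
    by move=> x /UVZ nZ [].
  (* Points of [F k] outside [V'] go to the first side and those outside [U'] to the second; added
     to the old closures they give closed sets still disjoint on [Z]. *)
  have cP' : closed (closure U `|` (F k `&` ~` V')).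
    by apply: closedU; [exact: closed_closure|apply: closedI => //; exact: open_closedC].
  have cQ' : closed (closure V `|` (F k `&` ~` U')).
    by apply: closedU; [exact: closed_closure|apply: closedI => //; exact: open_closedC].
  have [U1 [V1 [oU1 oV1 PU1 QV1 UV1]]] := closed_open_nbhd cP' cQ'.
  have PQ' x : Z x -> (closure U `|` (F k `&` ~` V')) x ->
                      (closure V `|` (F k `&` ~` U')) x -> False.
    move=> Zx [cUx|[Fx nV]] [cVx|[Fx' nU]].
    - exact: (UVZ x).
    - by apply: nU; exact: PU'.
    - by apply: nV; exact: QV'.
    - by have [] := ZUV' x (conj Zx Fx).
  exists (U1, V1); first by split=> // x /UV1[xP xQ] Zx; exact: (PQ' x).
  split=> /= x.
  - move=> [Zx Ux]; have xP : closure U x by exact: subset_closure.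
    by apply: PU1; split; [left|move=> xQ; apply: (PQ' x) => //; left].
  - move=> [Zx Vx]; have xQ : closure V x by exact: subset_closure.
    by apply: QV1; split; [left|move=> xP; apply: (PQ' x) => //; left].
  - move=> [Zx Fx]; have [U'x|V'x] := ZUV' x (conj Zx Fx).
      left; apply: PU1; have xP : (closure U `|` (F k `&` ~` V')) x.
        by right; split=> // V'x; exact: (UVZ' x).
      by split=> // xQ; exact: (PQ' x).
    right; apply: QV1; have xQ : (closure V `|` (F k `&` ~` U')) x.
      by right; split=> // U'x; exact: (UVZ' x).
    by split=> // xP; exact: (PQ' x).
have [f f0 fP] := dep_choice I0 step.
have mono i j : (i <= j)%N -> Z `&` (f i).1 `<=` (f j).1 /\ Z `&` (f i).2 `<=` (f j).2.
  move=> /subnKC <-; elim: (j - i)%N => [|m [IH1 IH2]].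
    by rewrite addn0; split=> x [].
  have [_ [S1 S2 _]] := fP (i + m)%N.
  by rewrite addnS; split=> x [Zx ?]; [apply: S1|apply: S2]; split=> //;
    [apply: IH1|apply: IH2].
exists (\bigcup_k (f k).1), (\bigcup_k (f k).2); split.
- by apply: bigcup_open => k _; have [[]] := fP k.
- by apply: bigcup_open => k _; have [[]] := fP k.
- by move=> x /ZPU ?; exists 0%N => //; rewrite f0.
- by move=> x /ZQV ?; exists 0%N => //; rewrite f0.
split=> [x Zx|x [[i _ xi] [j _ xj]] Zx].
  have [k _ Fx] := ZF _ Zx.
  have [_ [_ _ /(_ x (conj Zx Fx))[?|?]]] := fP k.
    by left; exists k.+1.
  by right; exists k.+1.
have [[_ _ disj] _] := fP (maxn i j).
apply: (disj x) => //; split; apply: subset_closure.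
  by apply: (mono _ _ (leq_maxl i j)).1.
by apply: (mono _ _ (leq_maxr i j)).2.
Qed.

Lemma zdim_bigcup Z (F : nat -> set X) : (forall k, closed (F k)) ->
  (forall k, zdim (Z `&` F k)) -> Z `<=` \bigcup_k F k -> zdim Z.
Proof.
move=> cF zF ZF Z' Z'Z; apply: (rel_sep_bigcup cF).
  by move=> k; apply: (zF k) => x [/Z'Z].
exact: subset_trans ZF.
Qed.

(** The [W i] trace a countable base of relatively clopen sets on [Z], the [W' i] their complements.
    Every point of [Z'] lies in some [W i] that misses [P] or [Q] on [Z']; taking the first such
    index makes the pieces disjoint. *)
Lemma zdim_base Z (W W' : nat -> set X) :
  (forall i, open (W i)) -> (forall i, open (W' i)) ->
  (forall i, Z `<=` W i `|` W' i) -> (forall i, W i `&` W' i `<=` ~` Z) ->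
  (forall x O, Z x -> open O -> O x -> exists2 i, W i x & Z `&` W i `<=` O) ->
  zdim Z.
Proof.
move=> oW oW' ZW WW' base Z' Z'Z P Q cP cQ PQ.
pose small i C := Z' `&` W i `<=` ~` C.
pose I i := small i P \/ small i Q.
(* Earlier sets are removed by meeting with their [W' j], which keeps [D i] open. *)
pose D i := W i `&` [set x | forall j, (j < i)%N -> I j -> W' j x].
have oD i : open (D i).
  apply: openI => //; elim: i => [|i IHi].
    by rewrite (_ : mkset _ = setT); [exact: openT|apply/seteqP].
  have [Ii|nIi] := pselect (I i).
    rewrite (_ : mkset _ = [set x | forall j, (j < i)%N -> I j -> W' j x] `&` W' i).
      exact: openI.
    apply/seteqP; split=> x /=.
      by move=> h; split=> [j ji|]; apply: h => //; exact: ltnW.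
    by move=> [h W'x] j; rewrite ltnS leq_eqVlt => /orP[/eqP->|/h].
  rewrite (_ : mkset _ = [set x | forall j, (j < i)%N -> I j -> W' j x])//.
  apply/seteqP; split=> x /= h j ji; first by apply: h; exact: ltnW.
  by move: ji; rewrite ltnS leq_eqVlt => /orP[/eqP->//|/h].
have ZD x : Z' x -> exists2 i, I i & D i x.
  move=> Z'x.
  have ex : exists i, `[< I i /\ W i x >].
    have [nP|] := pselect (~ P x).
      have [i Wx Wi] := base x _ (Z'Z _ Z'x) (closed_openC cP) nP.
      by exists i; apply/asboolP; split=> //; left=> y [/Z'Z Zy Wy]; exact: Wi.
    move=> /contrapT Px; have nQ : ~ Q x by move=> Qx; exact: (PQ x).
    have [i Wx Wi] := base x _ (Z'Z _ Z'x) (closed_openC cQ) nQ.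
    by exists i; apply/asboolP; split=> //; right=> y [/Z'Z Zy Wy]; exact: Wi.
  case: (ex_minnP ex) => i /asboolP[Ii Wx] mini; exists i => //; split=> // j ji Ij.
  have [Wjx|//] := ZW j x (Z'Z _ Z'x).
  by have := mini j; rewrite leqNgt ji => /(_ (asboolT (conj Ij Wjx))).
have Duniq x i j : Z' x -> I i -> I j -> D i x -> D j x -> i = j.
  wlog ij : i j / (i < j)%N.
    have [ij h|ij h|//] := ltngtP i j; first exact: h.
    by move=> *; apply/esym; apply: h.
  by move=> /Z'Z Zx Ii Ij [Wx _] [_ /(_ i ij Ii) W'x]; have := WW' i x (conj Wx W'x) Zx.
(* Pieces missing [Q] go to the side of [P]; the remaining ones miss [P]. *)
exists (\bigcup_(i in [set i | small i Q]) D i).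
exists (\bigcup_(i in [set i | I i /\ ~ small i Q]) D i).
split.
- exact: bigcup_open.
- exact: bigcup_open.
- move=> x [Z'x Px]; have [i Ii Dx] := ZD x Z'x; exists i => //=.
  by case: Ii => // /(_ x); case: Dx => Wx _ /(_ (conj Z'x Wx)).
- move=> x [Z'x Qx]; have [i Ii Dx] := ZD x Z'x; exists i => //=; split=> // /(_ x).
  by case: Dx => Wx _ /(_ (conj Z'x Wx)).
split=> [x Z'x|x [[i /= iQ Dix] [j [Ij jQ] Djx]] Z'x].
  have [i Ii Dx] := ZD x Z'x.
  by have [iQ|niQ] := pselect (small i Q); [left|right]; exists i.
apply: jQ; rewrite -(Duniq x i j)//; by right.
Qed.

(** [C m] minus the earlier sets is the union over [p] of the closed sets where the distance to the
    earlier ones is at least [1/(p+1)]. On each of these the whole union reduces to a part of [Z m],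
    so the sum theorem applies. *)
Lemma zdim_bigcup_seqDU (Z C : nat -> set X) :
  (forall m, closed (C m)) -> (forall m, zdim (Z m)) ->
  zdim (\bigcup_m (Z m `&` seqDU C m)).
Proof.
move=> cC zZ.
pose B m := \big[setU/set0]_(i < m) C i.
have cB m : closed (B m) by apply: closed_bigsetU.
pose F c := if @unpickle (nat * nat)%type c is Some (m, p) then
  C m `&` [set x | p.+1%:R^-1 <= tdist (B m) x] else set0.
apply: (@zdim_bigcup _ F).
- move=> c; rewrite /F; case: unpickle => [[m p]|]; last exact: closed0.
  apply: closedI => //; apply: continuous_closed_le; last exact: tdist_continuous.
  by move=> x; exact: cvg_cst.
- move=> c; rewrite /F; case: unpickle => [[m p]|]; last first.
    by apply: zdimS (zZ 0%N) => x [].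
  apply: zdimS (zZ m) => x [[k _ [Zx kx]] [Cx /= px]].
  have mx : seqDU C m x.
    split=> //; apply/(tdist_gt0 _ (cB m)); apply: lt_le_trans px.
    by rewrite invr_gt0.
  suff -> : m = k by [].
  apply: contrapT => /eqP mk; have /trivIsetP/(_ m k I I mk) := trivIset_seqDU C.
  by move=> /seteqP[/(_ x (conj mx kx))].
- move=> x [m _ [Zx [Cx nB]]].
  have d0 : 0 < tdist (B m) x by apply/tdist_gt0.
  have [p pP] : exists p, p.+1%:R^-1 <= tdist (B m) x.
    exists (Num.truncn (tdist (B m) x)^-1).
    rewrite -[leRHS]invrK lef_pV2 ?posrE ?invr_gt0//.
    by apply: ltW; exact: truncnS_gt.
  by exists (pickle (m, p)) => //; rewrite /F pickleK.
Qed.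

(** The complements of [U1] and [U2] do not meet in [Z]; the side of [Z] around the complement of
    [U1] lies in [U2], and conversely. *)
Lemma zdim_open_split Z U1 U2 : zdim Z -> open U1 -> open U2 ->
  Z `<=` U1 `|` U2 ->
  exists V1 V2, [/\ open V1 /\ V1 `<=` U1, open V2 /\ V2 `<=` U2,
    V1 `&` V2 = set0 & Z `<=` V1 `|` V2].
Proof.
move=> zZ oU1 oU2 ZU.
have [|U [V [oU oV PU QV [ZUV UVZ]]]] :=
    zZ Z (@subset_refl _ Z) _ _ (open_closedC oU1) (open_closedC oU2).
  by move=> x [n1 n2 /ZU[]].
have [G [G' [oG oG' UG VG GG']]] := rel_sep_open UVZ oU oV.
exists (G' `&` U1), (G `&` U2); split.
- by split; [exact: openI|move=> x []].
- by split; [exact: openI|move=> x []].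
- by apply/seteqP; split=> x // -[[G'x _] [Gx _]]; rewrite -GG'.
move=> x Zx; have [Ux|Vx] := ZUV _ Zx.
  right; split; first exact: UG.
  apply: contrapT => nU; apply: (UVZ x) => //; split=> //; exact: QV.
left; split; first exact: VG.
apply: contrapT => nU; apply: (UVZ x) => //; split=> //; exact: PU.
Qed.

Lemma zdim_disjoint_refinement k Z (U : nat -> set X) : zdim Z ->
  (forall i, open (U i)) -> Z `<=` \bigcup_(i in `I_k) U i ->
  exists V : nat -> set X, [/\ forall i, open (V i), forall i, V i `<=` U i,
    trivIset setT V & Z `<=` \bigcup_(i in `I_k) V i].
Proof.
move=> + oU; elim: k Z => [|k IHk] Z zZ ZU.
  exists (fun=> set0); split.
  - by move=> _; exact: open0.
  - by move=> i x.
  - by apply/trivIsetP => i j _ _ _; rewrite set0I.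
  - by move=> x /ZU[].
have [||V1 [V2 [[oV1 V1U] [oV2 V2U] V12 ZV]]] :=
    @zdim_open_split Z (U k) (\bigcup_(i in `I_k) U i) zZ (oU k).
- exact: bigcup_open.
- move=> x /ZU[i /=]; rewrite ltnS leq_eqVlt => /orP[/eqP->|ik] Ux; first by left.
  by right; exists i.
have [||V [oV VU tV ZV']] := IHk (Z `&` V2).
- by apply: zdimS zZ => x [].
- by move=> x [_ /V2U].
exists (fun i => if i == k then V1 else V i `&` V2); split.
- by move=> i; case: ifP => // _; exact: openI.
- by move=> i; case: eqP => [->//|_ x [/VU]].
- apply/trivIsetP => i j _ _ ij; apply/seteqP; split=> // x.
  have nV12 : V1 x -> V2 x -> False by move=> ? ?; rewrite -[False]/(set0 x) -V12.
  case: eqP => ik; case: eqP => jk.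
  + by rewrite ik jk eqxx in ij.
  + by move=> [V1x [_ /nV12]]; exact.
  + by move=> [[_ V2x] /nV12]; exact.
  + move=> [[Vi _] [Vj _]].
    by have /trivIsetP/(_ i j I I ij) := tV; move=> /seteqP[/(_ x (conj Vi Vj))].
- move=> x Zx; have [V1x|V2x] := ZV _ Zx.
    by exists k => /=; rewrite ?ltnSn// eqxx.
  have [i ik Vx] := ZV' x (conj Zx V2x); exists i => /=; first exact: ltnW.
  by rewrite (ltn_eqF ik).
Qed.

End ZeroDimensional.

(** * Hausdorff content and Hausdorff dimension *)
Section HausdorffContent.
Local Open Scope ereal_scope.
Context {R : realType} {X : metricType R}.
Implicit Types (A B C G U : set X) (s t e : R).

Lemma diam_ge0 U : 0 <= diam U.
Proof. by apply: ereal_sup_ubound; left. Qed.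

Lemma diam_le U (x : \bar R) : 0 <= x ->
  (forall p q, U p -> U q -> (mdist p q)%:E <= x) -> diam U <= x.
Proof.
move=> x0 Ux; apply: ge_ereal_sup => _ [->//|[[p q] [/= Up Uq] <-]].
exact: Ux.
Qed.

Lemma mdist_diam U p q : U p -> U q -> (mdist p q)%:E <= diam U.
Proof. by move=> Up Uq; apply: ereal_sup_ubound; right; exists (p, q). Qed.

Lemma diam0 : diam (set0 : set X) = 0.
Proof. by apply/eqP; rewrite eq_le diam_ge0 andbT diam_le. Qed.

Lemma diam_pow0 t : diam_pow t (set0 : set X) = 0.
Proof. by rewrite /diam_pow asboolT. Qed.

Lemma diam_powE t U : U !=set0 -> diam_pow t U = poweR (diam U) t.
Proof. by move=> /set0P/eqP U0; rewrite /diam_pow asboolF. Qed.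

Lemma diam_pow_ge0 t U : 0 <= diam_pow t U.
Proof. by rewrite /diam_pow; case: asboolP => // _; exact: poweR_ge0. Qed.

Lemma diam_pow_anti s t U : (0 <= s <= t)%R -> diam U <= 1 ->
  diam_pow t U <= diam_pow s U.
Proof.
move=> /andP[s0 st]; rewrite /diam_pow; case: asboolP => // _.
have := diam_ge0 U; case: (diam U) => //= r; rewrite !lee_fin => r0 r1.
have [->|rn0] := eqVneq r 0%R.
  have [->|sn0] := eqVneq s 0%R; last first.
    by rewrite !powR0// gt_eqF// (lt_le_trans _ st)// lt0r sn0.
  by rewrite powRr0; have [->|tn0] := eqVneq t 0%R; rewrite ?powRr0// powR0.
by apply: ger_powR => //; rewrite lt0r rn0 r0.
Qed.

Lemma hausdorff_content_ge0 t A : 0 <= hausdorff_content t A.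
Proof.
apply: le_ereal_inf_tmp => _ [U _ <-].
by apply: nneseries_ge0 => i _ _; exact: diam_pow_ge0.
Qed.

Lemma hausdorff_content_le t A (U : nat -> set X) : A `<=` \bigcup_i U i ->
  hausdorff_content t A <= \sum_(0 <= i <oo) diam_pow t (U i).
Proof.
by move=> AU; apply: ereal_inf_lbound; exists U => //; split=> // i; exact: leey.
Qed.

Lemma hausdorff_content_lt t A (e : \bar R) : hausdorff_content t A < e ->
  exists2 U : nat -> set X, A `<=` \bigcup_i U i &
    \sum_(0 <= i <oo) diam_pow t (U i) < e.
Proof. by move=> /ereal_inf_lt[_ [U [AU _] <-]] Ue; exists U. Qed.

Lemma hausdorff_contentS t A B : A `<=` B ->
  hausdorff_content t A <= hausdorff_content t B.
Proof.
move=> AB; apply: le_ereal_inf_tmp => _ [U [BU _] <-].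
by apply: hausdorff_content_le; exact: subset_trans BU.
Qed.

Lemma hausdorff_content0_le t A :
  (forall e, (0 < e)%R -> hausdorff_content t A <= e%:E) ->
  hausdorff_content t A = 0.
Proof.
move=> h; apply/eqP; rewrite eq_le hausdorff_content_ge0 andbT.
by apply/lee_addgt0Pr => e e0; rewrite add0e; exact: h.
Qed.

Lemma hausdorff_content0S t A B : A `<=` B -> hausdorff_content t B = 0 ->
  hausdorff_content t A = 0.
Proof.
move=> AB B0; apply/eqP; rewrite eq_le hausdorff_content_ge0 andbT.
by rewrite -B0 hausdorff_contentS.
Qed.

Lemma hausdorff_content_set0 t : hausdorff_content t (set0 : set X) = 0.
Proof.
apply: hausdorff_content0_le => e e0.
apply: (@le_trans _ _ (\sum_(0 <= i <oo) diam_pow t (set0 : set X))).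
  exact: (@hausdorff_content_le t set0 (fun=> set0)).
by rewrite eseries0 ?lee_fin ?ltW// => *; exact: diam_pow0.
Qed.

Lemma hausdorff_content0_bigcup t (A : nat -> set X) :
  (forall i, hausdorff_content t (A i) = 0) ->
  hausdorff_content t (\bigcup_i A i) = 0.
Proof.
move=> A0; apply: hausdorff_content0_le => e e0.
have /choice[U UP] : forall i, exists U : nat -> set X,
    A i `<=` \bigcup_j U j /\
    \sum_(0 <= j <oo) diam_pow t (U j) <= (e / (2 ^ i.+1)%:R)%:E.
  move=> i; have [|U AU Ue] := @hausdorff_content_lt t (A i) (e / (2 ^ i.+1)%:R)%:E.
    by rewrite A0 lte_fin divr_gt0// ltr0n expn_gt0.
  by exists U; split=> //; exact: ltW.
have /card_esym/ppcard_eqP[f] := card_nat2.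
pose c (p : nat * nat) := diam_pow t (U p.1 p.2).
apply: (@le_trans _ _ (\sum_(0 <= m <oo) c (f m))).
  apply: (@hausdorff_content_le t _ (fun m => U (f m).1 (f m).2)) => x [i _].
  move=> /(UP i).1[j _ Ux]; exists (f^-1%FUN (i, j)) => //=.
  by rewrite invK ?inE.
rewrite nneseries_esumT; last by move=> m; exact: diam_pow_ge0.
rewrite -(reindex_esum setT setT f c); last exact: 'bij_f.
rewrite (_ : [set: nat * nat] = [set: nat] `*`` (fun=> [set: nat])); last first.
  by apply/seteqP; split.
rewrite -(@esum_esum _ _ _ _ _ (fun i j => c (i, j))); last first.
  by move=> *; exact: diam_pow_ge0.
rewrite -nneseries_esumT; last by move=> i; apply: esum_ge0 => *; exact: diam_pow_ge0.
apply: le_trans (epsilon_trick0 xpredT (ltW e0)).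
apply: lee_nneseries => [i _ _|i _]; first by apply: esum_ge0 => *; exact: diam_pow_ge0.
rewrite -nneseries_esumT; last by move=> *; exact: diam_pow_ge0.
exact: (UP i).2.
Qed.

Lemma diam_pow_le_sum t (U : nat -> set X) i :
  diam_pow t (U i) <= \sum_(0 <= j <oo) diam_pow t (U j).
Proof.
rewrite (@nneseriesD1 _ _ i)//; last by move=> *; exact: diam_pow_ge0.
by rewrite leeDl//; apply: nneseries_ge0 => *; exact: diam_pow_ge0.
Qed.

Lemma diam_pow_open_hull t U e : (0 < t)%R -> (0 < e)%R -> diam_pow t U < +oo ->
  exists W, [/\ open W, U `<=` W & diam_pow t W <= diam_pow t U + e%:E].
Proof.
move=> t0 e0; have [->|/set0P U0] := eqVneq U set0.
  move=> _; exists set0; split=> //; first exact: open0.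
  by rewrite diam_pow0 add0e lee_fin ltW.
rewrite diam_powE//; have := diam_ge0 U.
case dU : (diam U) => [r| |] //; last first.
  by move=> _ /(lty_poweRy (lt0r_neq0 t0)).
rewrite lee_fin => r0 _; rewrite poweR_EFin.
(* [r'] solves [r'^t = r^t + e]; fattening by half of [r' - r] on each side takes the diameter from
   [r] to at most [r']. *)
pose r' := ((r `^ t + e) `^ t^-1)%R.
have r'0 : (0 <= r')%R by exact: powR_ge0.
have r't : (r' `^ t = r `^ t + e)%R.
  rewrite /r' -powRrM mulVf ?lt0r_neq0// powRr1//.
  by rewrite addr_ge0 ?powR_ge0// ltW.
have rr' : (r < r')%R.
  rewrite ltNge; apply/negP => r'r.
  have : (r' `^ t <= r `^ t)%R by apply: ge0_ler_powR => //; exact: ltW.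
  by rewrite r't leNgt ltrDl e0.
pose h := ((r' - r) / 2)%R.
have h0 : (0 < h)%R by rewrite divr_gt0// subr_gt0.
exists (\bigcup_(u in U) [set y | (mdist u y < h)%R]); split.
- by apply: bigcup_open => u _; exact: open_mdist_lt.
- by move=> u Uu; exists u => //=; rewrite mdistxx.
rewrite diam_powE; last first.
  by have [u Uu] := U0; exists u, u => //=; rewrite mdistxx.
rewrite -EFinD -r't -poweR_EFin; apply: gt0_ler_poweR; first exact: ltW.
- by rewrite in_itv/= diam_ge0 leey.
- by rewrite in_itv/= lee_fin r'0 leey.
apply: diam_le; first by rewrite lee_fin.
move=> p q [u Uu /= up] [v Uv /= vq]; rewrite lee_fin.
have := mdist_diam Uu Uv; rewrite dU lee_fin => uv.
have := metric_triangle p u q; have := metric_triangle u v q.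
rewrite (metric_sym p u) => h1 h2; rewrite (_ : r' = h + r + h)%R; last first.
  by rewrite /h; field.
by lra.
Qed.

Lemma hausdorff_content_open_hull t A e : (0 < t)%R -> (0 < e)%R ->
  hausdorff_content t A = 0 ->
  exists G, [/\ open G, A `<=` G & hausdorff_content t G <= e%:E].
Proof.
move=> t0 e0 A0; have e20 : (0 < e / 2)%R by rewrite divr_gt0.
have [|U AU Ue] := @hausdorff_content_lt t A (e / 2)%:E; first by rewrite A0 lte_fin.
have Ufin i : diam_pow t (U i) < +oo.
  exact: le_lt_trans (diam_pow_le_sum t U i) (lt_trans Ue (ltry _)).
have /choice[W WP] : forall i, exists W, [/\ open W, U i `<=` W &
    diam_pow t W <= diam_pow t (U i) + (e / 2 / (2 ^ i.+1)%:R)%:E].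
  by move=> i; apply: diam_pow_open_hull => //; rewrite divr_gt0// ltr0n expn_gt0.
exists (\bigcup_i W i); split.
- by apply: bigcup_open => i _; have [] := WP i.
- by move=> x /AU[i _ Ux]; exists i => //; have [_ UW _] := WP i; exact: UW.
apply: le_trans (hausdorff_content_le _ (@subset_refl _ _)) _.
apply: (@le_trans _ _
    (\sum_(0 <= i <oo) (diam_pow t (U i) + (e / 2 / (2 ^ i.+1)%:R)%:E))).
  apply: lee_nneseries => [*|i _]; first exact: diam_pow_ge0.
  by have [] := WP i.
apply: le_trans (epsilon_trick _ _ (ltW e20)) _.
  by move=> *; exact: diam_pow_ge0.
by rewrite [e in leRHS]splitr EFinD leeD2r// ltW.
Qed.

(** * Hausdorff dimension expressed through the content *)

Lemma hdim_lt_content A t : (0 < t)%R -> hdim A < t%:E -> hausdorff_content t A = 0.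
Proof.
move=> t0; rewrite /hdim; case: asboolP => [-> _|_].
  exact: hausdorff_content_set0.
move=> /ereal_inf_lt[_ [s /= [s0 As] <-]]; rewrite lte_fin => st.
apply: hausdorff_content0_le => e e0.
(* At scale 1 all diameters are at most 1, so raising the exponent from [s] to [t] only lowers the
   terms. *)
have : hausdorff_premeasure 1%:E s A < e%:E.
  apply: (@le_lt_trans _ _ 0); last by rewrite lte_fin.
  by rewrite -As; apply: ereal_sup_ubound; exists 1%R => //=.
move=> /ereal_inf_lt[_ [U [AU U1] <-]] /ltW; apply: le_trans.
apply: le_trans (hausdorff_content_le _ AU) _.
apply: lee_nneseries => [*|i _]; first exact: diam_pow_ge0.
by apply: diam_pow_anti => //; rewrite s0 ltW.
Qed.

(** A cover with a small sum of powers has only small members, so small contents control the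
    premeasures at every scale, and the measure vanishes for each exponent above [s]. *)
Lemma hdim_le C s : (0 <= s)%R ->
  (forall e, (0 < e)%R -> exists e', [/\ (0 < e')%R, (e' <= e)%R &
     hausdorff_content (s + e') C <= e'%:E]) ->
  hdim C <= s%:E.
Proof.
move=> s0 Ce; rewrite /hdim; case: asboolP => [_|_].
  by rewrite (le_trans leeN10)// lee_fin.
apply/lee_addgt0Pr => e e0; apply: ereal_inf_lbound; exists (s + e)%R => //=.
have se0 : (0 <= s + e)%R by rewrite addr_ge0// ltW.
split=> //; apply/eqP; rewrite eq_le; apply/andP; split; last first.
  apply: (@le_trans _ _ (hausdorff_premeasure 1%:E (s + e) C)).
    apply: le_ereal_inf_tmp => _ [U _ <-].
    by apply: nneseries_ge0 => *; exact: diam_pow_ge0.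
  by apply: ereal_sup_ubound; exists 1%R => //=.
apply: ge_ereal_sup => _ [d /= d0 <-].
apply/lee_addgt0Pr => h h0; rewrite add0e.
pose d1 := Num.min d 1%R.
have d10 : (0 < d1)%R by rewrite lt_min d0 ltr01.
have d11 : (d1 <= 1)%R by rewrite ge_min lexx orbT.
(* A sum below [d1^(s+e)] excludes members of diameter above [d1] for every exponent [s + e'] with
   [e' <= e], because [d1 <= 1]; [h] bounds the final sum. *)
pose b : R := Num.min h (d1 `^ (s + e))%R.
have b0 : (0 < b)%R by rewrite lt_min h0 powR_gt0.
have [|e' [e'0 e'le Ce']] := Ce (Num.min e (b / 2))%R.
  by rewrite lt_min e0 divr_gt0.
move: e'le; rewrite le_min => /andP[e'e e'b].
have : hausdorff_content (s + e') C < b%:E.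
  apply: le_lt_trans Ce' _; rewrite lte_fin (le_lt_trans e'b)//.
  by rewrite ltr_pdivrMr// ltr_pMr// ltr1n.
move=> /hausdorff_content_lt[U CU Ub].
have Ui i : diam (U i) <= d1%:E.
  have [->|/set0P U0] := eqVneq (U i) set0; first by rewrite diam0 lee_fin ltW.
  rewrite leNgt; apply/negP => d1U.
  suff : b%:E <= diam_pow (s + e') (U i).
    rewrite leNgt => /negP; apply; apply: le_lt_trans Ub.
    exact: diam_pow_le_sum.
  rewrite diam_powE//; apply: (@le_trans _ _ (poweR d1%:E (s + e'))).
    rewrite poweR_EFin lee_fin; apply: (@le_trans _ _ (d1 `^ (s + e))%R).
      by rewrite ge_min lexx orbT.
    by apply: ger_powR; [rewrite d10|rewrite lerD2l].
  apply: gt0_ler_poweR; last exact: ltW.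
  - by rewrite addr_ge0// ltW.
  - by rewrite in_itv/= lee_fin ltW//= leey.
  - by rewrite in_itv/= diam_ge0 leey.
apply: (@le_trans _ _ (\sum_(0 <= i <oo) diam_pow (s + e) (U i))).
  apply: ereal_inf_lbound; exists U => //; split=> // i.
  by rewrite (le_trans (Ui i))// lee_fin ge_min lexx.
apply: (@le_trans _ _ (\sum_(0 <= i <oo) diam_pow (s + e') (U i))).
  apply: lee_nneseries => [*|i _]; first exact: diam_pow_ge0.
  apply: diam_pow_anti; first by rewrite addr_ge0 ?(ltW e'0)//= lerD2l.
  by rewrite (le_trans (Ui i))// lee_fin.
by rewrite (le_trans (ltW Ub))// lee_fin ge_min lexx.
Qed.

(** For [s >= 0] this is [hdim A <= s], in a form that passes at once to subsets and countable
    unions. *)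
Definition hdim_null s A := forall t, (s < t)%R -> hausdorff_content t A = 0.

Lemma hdim_nullP s A : (0 <= s)%R -> hdim A <= s%:E <-> hdim_null s A.
Proof.
move=> s0; split=> [As t st|As].
  by apply: hdim_lt_content; [exact: le_lt_trans st|exact: le_lt_trans As _].
apply: hdim_le => // e e0; exists e; split=> //.
by rewrite As ?ltrDl// lee_fin ltW.
Qed.

Lemma hdim_nullS s A B : A `<=` B -> hdim_null s B -> hdim_null s A.
Proof.
by move=> AB Bs t /Bs; exact: hausdorff_content0S.
Qed.

Lemma hdim_null_bigcup s (A : nat -> set X) : (forall i, hdim_null s (A i)) ->
  hdim_null s (\bigcup_i A i).
Proof. by move=> As t st; apply: hausdorff_content0_bigcup => i; exact: As. Qed.

End HausdorffContent.

(** * Inductive dimensions over an ideal *)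

Section InductiveDimension.
Context {R : realType} {X : metricType R}.
Implicit Types (A B E J L U W Z : set X) (I : set (set X)).

Lemma separable_dense_seq : separable X -> X -> exists d : nat -> X,
  forall x (e : R), 0 < e -> exists k, mdist x (d k) < e.
Proof.
move=> [D cD dD] x0.
have /pfcard_geP[D0|[f]] := cD.
  have [] := dD setT; [by exists x0|exact: openT|].
  by move=> x; rewrite D0 setI0.
exists f => x e e0.
have [] := dD [set y | mdist x y < e] _ (open_mdist_lt x e).
  by exists x; rewrite /= mdistxx.
by move=> y [/= xy Dy]; have [k _ fk] := @surj _ _ _ _ f _ Dy; exists k; rewrite fk.
Qed.

Lemma dense_seq_base (d : nat -> X) :
  (forall x (e : R), 0 < e -> exists k, mdist x (d k) < e) ->
  forall x W, open W -> W x -> exists k m,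
    mdist (d k) x < m.+1%:R^-1 / 2 /\ [set y | mdist (d k) y < m.+1%:R^-1] `<=` W.
Proof.
move=> dd x W oW Wx.
have [e e0 eW] := nbhs_mdistP (open_nbhs_nbhs (conj oW Wx)).
pose m := Num.truncn (2 / e).
have m0 : 0 < m.+1%:R^-1 :> R by rewrite invr_gt0.
have me : m.+1%:R^-1 < e / 2.
  rewrite -[ltRHS]invrK invf_div ltf_pV2 ?posrE ?divr_gt0//.
  exact: truncnS_gt.
have [k kx] := dd x (m.+1%:R^-1 / 2) (divr_gt0 m0 (ltr0n _ 2)).
exists k, m; rewrite metric_sym; split=> // y /= ky; apply: eW.
apply: le_lt_trans (metric_triangle x (d k) y) _.
by move: (m.+1%:R^-1) => r in m0 me kx ky *; lra.
Qed.

(** For each pair of balls from a countable family, one member of [BB] lying between them on [A] is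
    chosen, if there is any. This suffices, since a member of [BB] contains the trace of a smaller
    ball around each of its points. *)
Lemma basis_countable A BB : separable X -> A !=set0 -> basis_of A BB ->
  exists U : nat -> set X, (forall i, BB (U i)) /\
    forall x W, A x -> open W -> W x -> exists i, U i x /\ U i `<=` W.
Proof.
move=> sX [a Aa] [BBo BBb]; have [d dd] := separable_dense_seq sX a.
have base := dense_seq_base dd.
pose b (p : nat * nat) := [set y | mdist (d p.1) y < p.2.+1%:R^-1].
pose sand U p := A `&` b p.1 `<=` U /\ U `<=` b p.2.
have /choice[U UP] : forall c : nat, exists U, BB U /\
    forall p, unpickle c = Some p -> (exists2 V, BB V & sand V p) -> sand U p.
  move=> c; have [V [BV _ _]] := BBb a setT Aa openT I.
  case: (unpickle c) => [p|]; last by exists V.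
  have [[V' BV' V'p]|nV] := pselect (exists2 V, BB V & sand V p).
    by exists V'; split=> // _ [<-].
  by exists V; split=> // _ [<-] /nV.
exists U; split=> [i|x W Ax oW Wx]; first by have [] := UP i.
have [k [m [kx kmW]]] := base x W oW Wx.
have ob p : open (b p) by exact: open_mdist_lt.
have half m' y k' : mdist (d k') y < m'.+1%:R^-1 / 2 -> b (k', m') y.
  move=> /lt_le_trans; apply; rewrite ler_pdivrMr// ler_pMr ?invr_gt0//.
  by rewrite ler1n.
have [V [BV Vx Vkm]] := BBb x (b (k, m)) Ax (ob _) (half _ _ _ kx).
have [G oG VG] := BBo V BV.
have Gx : G x by move: Vx; rewrite VG => -[].
have [k' [m' [kx' kmG]]] := base x G oG Gx.
have VP : sand V ((k', m'), (k, m)).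
  by split=> // y [Ay /kmG]; rewrite VG.
have [_ /(_ _ (pickleK _))/(_ (ex_intro2 _ _ V BV VP))[h1 h2]] :=
  UP (pickle ((k', m'), (k, m))).
exists (pickle ((k', m'), (k, m))); split; last exact: subset_trans kmW.
by apply: h1; split=> //; exact: half.
Qed.

(* Both dimensions of the theorem are instances: [I] consists of the empty set
   for [tdim], and of the sets of Hausdorff dimension at most [s] for [thdim]. *)
Fixpoint dim_over I k A : Prop :=
  if k is j.+1 then
    exists2 BB, basis_of A BB & forall U, BB U -> dim_over I j (boundary_in A U)
  else I A.

Definition sigma_stable I :=
  I set0 /\ forall F : nat -> set X, (forall i, I (F i)) -> I (\bigcup_i F i).

Lemma dim_over_set0 I k : I set0 -> dim_over I k set0.
Proof. by case: k => //= k _; exists set0. Qed.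

Lemma tdim_lt_dim_over k A : tdim_lt k A <-> dim_over [set set0] k A.
Proof.
elim: k A => //= k IH A.
by split=> -[BB bBB BBk]; exists BB => // U /BBk /IH.
Qed.

Lemma zdim0 : zdim (set0 : set X).
Proof.
move=> Z'; rewrite subset0 => -> P Q _ _ _; exists set0, set0.
by split; rewrite ?set0I//; first [exact: open0|split=> x []].
Qed.

Lemma boundary_inP A U x : A x -> open_in A U ->
  ~ boundary_in A U x -> U x \/ ~ closure U x.
Proof.
move=> Ax [W oW UW] nb; have [cU|] := pselect (closure U x); last by right.
left; apply: contrapT => nU; apply: nb; split; first by split.
exact: subset_closure.
Qed.

Lemma dim_over_decomp I n E : separable X -> sigma_stable I -> dim_over I n E ->
  exists J (Z : nat -> set X),
    [/\ I J, forall i, zdim (Z i) & E `<=` J `|` \bigcup_(i in `I_n) Z i].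
Proof.
move=> sX [I0 Icup]; elim: n E => [|n IH] E /=.
  by move=> IE; exists E, (fun=> set0); split=> [//|_|x]; [exact: zdim0|left].
move=> [BB bBB BBn].
have [->|/set0P E0] := eqVneq E set0.
  by exists set0, (fun=> set0); split=> // _; exact: zdim0.
have [U [BU Ubase]] := basis_countable sX E0 bBB.
have Uo m : open_in E (U m) by apply: bBB.1.
(* The trace of [C m] on [E] is the boundary of [U m] in [E]; [C m] itself is closed in the whole
   space, as the sum theorem requires. *)
pose C m := closure (U m) `&` closure (E `\` U m).
have cC m : closed (C m) by apply: closedI; exact: closed_closure.
have /choice[JZ JZP] : forall m, exists JZ : set X * (nat -> set X),
    [/\ I JZ.1, forall i, zdim (JZ.2 i) &
        E `&` C m `<=` JZ.1 `|` \bigcup_(i in `I_n) JZ.2 i].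
  move=> m; have [J [Z [IJ zZ JZ]]] := IH _ (BBn _ (BU m)).
  by exists (J, Z); split=> //=; rewrite /C setIA.
exists (\bigcup_m (JZ m).1).
(* Off all the boundaries the [U m] are relatively clopen, which gives the new set of index [n]. For
   smaller indices, the sets from different boundaries are glued along the disjointed [C m], so that
   their union stays zero-dimensional. *)
exists (fun i => if i == n then E `\` \bigcup_m C m else
  \bigcup_m ((JZ m).2 i `&` seqDU C m)); split.
- by apply: Icup => m; have [] := JZP m.
- move=> i; case: eqP => _; last first.
    by apply: zdim_bigcup_seqDU => // m; have [_ + _] := JZP m; exact.
  have /choice[W WP] : forall m, exists W, open W /\ U m = E `&` W.
    by move=> m; have [W oW UW] := Uo m; exists W.
  apply: (@zdim_base _ _ _ W (fun m => ~` closure (U m))).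
  + by move=> m; have [] := WP m.
  + by move=> m; apply: closed_openC; exact: closed_closure.
  + move=> m x [Ex nC]; have [|Ux|ncU] := boundary_inP Ex (Uo m).
    * by move=> [[_ ?] ?]; apply: nC; exists m.
    * by left; move: Ux; rewrite (WP m).2 => -[].
    * by right.
  + move=> m x [Wx ncU] [Ex _]; apply: ncU; apply: subset_closure.
    by rewrite (WP m).2.
  + move=> x G [Ex _] oG Gx; have [m [Ux UG]] := Ubase x G Ex oG Gx.
    exists m; first by move: Ux; rewrite (WP m).2 => -[].
    by move=> y [[Ey _] Wy]; apply: UG; rewrite (WP m).2.
- move=> x Ex; have [|nC] := pselect ((\bigcup_m C m) x); last first.
    by right; exists n => //=; rewrite eqxx.
  rewrite seqDU_bigcup_eq => -[m _ Dx].
  have Cx : C m x by case: Dx.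
  have [_ _ /(_ x (conj Ex Cx))[Jx|[i /= ni Zx]]] := JZP m.
    by left; exists m.
  right; exists i => /=; first exact: ltnW.
  by rewrite (ltn_eqF ni); exists m.
Qed.

Lemma zdim_partitions n (Z A B : 'I_n -> set X) :
  (forall i, zdim (Z i)) ->
  (forall i, [/\ closed (A i), closed (B i) & A i `&` B i = set0]) ->
  exists L : 'I_n -> set X, (forall i, partition_between (A i) (B i) (L i)) /\
    \bigcap_i L i `<=` ~` \bigcup_i Z i.
Proof.
move=> zZ AB.
have /choice[L LP] : forall i, exists L, partition_between (A i) (B i) L /\
    L `<=` ~` Z i.
  move=> i; have [cA cB AB0] := AB i.
  have [L LP LZ] := rel_sep_partition (zZ i _ (@subset_refl _ _)) cA cB AB0.
  by exists L.
exists L; split=> [i|x Lx [i _]]; first by have [] := LP i.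
by have [_] := LP i; apply; exact: Lx.
Qed.

Lemma dim_over_partitions I n E (A B : 'I_n -> set X) :
  separable X -> sigma_stable I -> dim_over I n E ->
  (forall i, [/\ closed (A i), closed (B i) & A i `&` B i = set0]) ->
  exists L : 'I_n -> set X, (forall i, partition_between (A i) (B i) (L i)) /\
    exists2 J, I J & E `&` \bigcap_i L i `<=` J.
Proof.
move=> sX sI En AB; have [J [Z [IJ zZ EJZ]]] := dim_over_decomp sX sI En.
have [L [LP LZ]] := zdim_partitions (fun i : 'I_n => zZ i) AB.
exists L; split=> //; exists J => // x [/EJZ[//|[i /= ni Zx]] Lx].
by have := LZ x Lx; case; exists (Ordinal ni).
Qed.

(** * Inductive topological Hausdorff dimension in terms of ideals *)

Local Open Scope ereal_scope.

Lemma thdimS_lt n A (t : R) : A !=set0 -> thdim n.+1 A < (t + n.+1%:R)%:E ->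
  exists2 BB, basis_of A BB & forall U, BB U ->
    thdim n (boundary_in A U) < (t + n%:R)%:E.
Proof.
move=> /set0P/eqP A0; rewrite /= asboolF//.
move=> /ereal_inf_lt[d /= [BB bBB BBd] dt]; exists BB => // U /BBd Ud.
apply: (le_lt_trans Ud); change (d - 1 < (t + n%:R)%:E).
rewrite lteBlDr// -EFinD -addrA natr1.
exact: dt.
Qed.

Lemma dim_over_thdim n A (t : R) : (0 < t)%R -> thdim n A < (t + n%:R)%:E ->
  dim_over [set B | hausdorff_content t B = 0] n A.
Proof.
move=> t0; elim: n A => [|n IH] A.
  rewrite addr0 /=; case: asboolP => [->|_]; first by rewrite hausdorff_content_set0.
  exact: hdim_lt_content.
have [-> _|/set0P A0 /(thdimS_lt A0)[BB bBB BBn]] := eqVneq A set0.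
  exact/dim_over_set0/hausdorff_content_set0.
by exists BB => // U /BBn; exact: IH.
Qed.

(** Hausdorff dimension below 0 forces emptiness, so the recursion bottoms out as for [tdim_lt]. By
    contraposition, topological dimension at least [n] gives [thdim n] at least [n]. *)
Lemma thdim_lt_tdim_lt n A : thdim n A < n%:R%:E -> tdim_lt n A.
Proof.
elim: n A => [|n IH] A.
  rewrite /= /hdim; case: asboolP => // nA0 /ereal_inf_lt[_ [s /= [s0 _] <-]].
  by rewrite lte_fin ltNge s0.
have [-> _|/set0P A0] := eqVneq A set0; first exact: tdim_lt_set0.
rewrite -[n.+1%:R]add0r => /(thdimS_lt A0)[BB bBB BBn].
by exists BB => // U /BBn; rewrite add0r; exact: IH.
Qed.

Lemma thdim_dim_over n A (s : R) : (0 <= s)%R -> dim_over (hdim_null s) n A ->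
  thdim n A <= (s + n%:R)%:E.
Proof.
move=> s0; elim: n A => [|n IH] A.
  rewrite addr0 /= => /(hdim_nullP _ s0) As; case: asboolP => // _.
  by rewrite (le_trans leeN10)// lee_fin.
move=> [BB bBB BBn] /=; case: asboolP => [_|_].
  by rewrite (le_trans leeN10)// lee_fin addr_ge0.
apply: ereal_inf_lbound; exists BB => // U /BBn/IH.
by rewrite -EFinB -addrA -natr1 addrK.
Qed.

End InductiveDimension.

(** * Sequences of partitions *)

Section PartitionSequences.
Context {R : realType} {X : metricType R}.
Implicit Types (A B E G L U V : set X) (I : set (set X)).

Definition small_partitions n (s : R) := forall e : R, 0 < e ->
  forall A B : 'I_n -> set X,
    (forall i, [/\ closed (A i), closed (B i) & A i `&` B i = set0]) ->
    exists (L : 'I_n -> set X) G, [/\ forall i, partition_between (A i) (B i) (L i),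
      open G, \bigcap_i L i `<=` G & (hausdorff_content (s + e) G <= e%:E)%E].

(* The thickened partitions are [{|h_j| <= rho}], where [h_j] changes sign
   across [L_j] and [rho] is a small multiple of the sum of the [|h_j|] and of
   the distance to the complement of [G]. *)
Lemma thicken_partitions n (A B L : 'I_n -> set X) G :
  (forall j, closed (A j)) -> (forall j, closed (B j)) ->
  (forall j, partition_between (A j) (B j) (L j)) ->
  open G -> \bigcap_j L j `<=` G ->
  exists U V : 'I_n -> set X,
    (forall j, [/\ open (U j), open (V j), A j `&` closure (V j) = set0,
       closure (U j) `&` B j = set0 & closure (U j) `&` closure (V j) = set0]) /\
    \bigcap_j ~` (U j `|` V j) `<=` G.
Proof.
move=> cA cB LP oG LG.
have /choice[h hP] : forall j, exists h : X -> R, [/\ continuous h,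
    forall x, A j x -> 0 < h x, forall x, B j x -> h x < 0 &
    forall x, h x = 0 -> L j x].
  move=> j; have [U [V [[oU oV] AU BV UV ->]]] := LP j.
  have cU := open_closedC oU; have cV := open_closedC oV.
  have dU0 x : ~ U x -> tdist (~` U) x = 0.
    by move=> nU; apply/tdist_eq0; exact: subset_closure.
  have dV0 x : ~ V x -> tdist (~` V) x = 0.
    by move=> nV; apply/tdist_eq0; exact: subset_closure.
  have dU x : U x -> 0 < tdist (~` U) x by move=> Ux; apply/(tdist_gt0 _ cU) => /(_ Ux).
  have dV x : V x -> 0 < tdist (~` V) x by move=> Vx; apply/(tdist_gt0 _ cV) => /(_ Vx).
  have nVU x : U x -> ~ V x by move=> Ux Vx; move/disjointP : UV => /(_ x Ux Vx).
  exists (fun x => tdist (~` U) x - tdist (~` V) x); split.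
  - by move=> x; apply: continuousB; exact: tdist_continuous.
  - by move=> x /AU Ux; rewrite dV0 ?subr0; [exact: dU|exact: nVU].
  - move=> x /BV Vx; rewrite dU0 ?sub0r ?oppr_lt0; first exact: dV.
    by move=> /nVU.
  - move=> x h0 [Ux|Vx].
      by have := dU x Ux; rewrite (subr0_eq h0) dV0 ?ltxx//; exact: nVU.
    by have := dV x Vx; rewrite -(subr0_eq h0) dU0 ?ltxx// => /nVU.
pose g := tdist (~` G).
pose sigma x := g x + \sum_j `|h j x|.
have csigma : continuous sigma.
  move=> x; apply: continuousD; first exact: tdist_continuous.
  apply: cvg_big => [|j _]; first exact: add_continuous.
  apply: cvg_norm; have [+ _ _ _] := hP j; exact.
(* The divisor exceeds the number of partitions: off [G], the [n] bounds [|h_j| <= rho] would give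
   [sigma <= n sigma / (n+1)], although [sigma > 0]. *)
pose rho x := sigma x / n.+1%:R.
have crho : continuous rho by move=> x; apply: continuousM; [exact: csigma|exact: cvg_cst].
have sum0 x : 0 <= \sum_j `|h j x| by apply: sumr_ge0.
(* Where all [h j] vanish the point is in every [L j], hence in [G], and there [g] is positive. *)
have sigma0 x : 0 < sigma x.
  rewrite lt0r addr_ge0 ?tdist_ge0// andbT.
  apply/negP; rewrite paddr_eq0 ?tdist_ge0// => /andP[/eqP g0].
  rewrite psumr_eq0// => /allP hx0; suff Gx : G x.
    have := (tdist_gt0 x (open_closedC oG)).2 (fun nG => nG Gx).
    by rewrite -/g g0 ltxx.
  apply: LG => j _; have [_ _ _] := hP j; apply.
  by apply/normr0_eq0/eqP/hx0; rewrite mem_index_enum.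
have rho0 x : 0 < rho x by rewrite divr_gt0.
have crhoN : continuous (fun x => - rho x).
  by move=> x; apply: continuousN; exact: crho.
exists (fun j => [set x | rho x < h j x]), (fun j => [set x | h j x < - rho x]).
have clU j : closure [set x | rho x < h j x] `<=` [set x | rho x <= h j x].
  apply: closure_sub_closed; last by move=> x /ltW.
  by apply: continuous_closed_le => //; have [] := hP j.
have clV j : closure [set x | h j x < - rho x] `<=` [set x | h j x <= - rho x].
  apply: closure_sub_closed; last by move=> x /ltW.
  by apply: continuous_closed_le => //; have [] := hP j.
split.
  move=> j; have [ch hA hB _] := hP j; split.
  - exact: continuous_open_lt.
  - exact: continuous_open_lt.
  - apply/disjointP => x /hA hx /clV /= hx'; have := rho0 x; lra.
  - apply/disjointP => x /clU /= hx' /hB hx; have := rho0 x; lra.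
  - apply/disjointP => x /clU /= h1 /clV /= h2; have := rho0 x; lra.
move=> x xUV; apply: contrapT => nG.
have g0 : g x = 0 by apply/tdist_eq0; exact: subset_closure.
have hle j : `|h j x| <= rho x.
  rewrite ler_norml; apply/andP; split; rewrite leNgt; apply/negP => hx.
    by apply: (xUV j I); right.
  by apply: (xUV j I); left.
have : \sum_j `|h j x| <= \sum_(j < n) rho x by apply: ler_sum => j _; exact: hle.
rewrite sumr_const card_ord.
have -> : \sum_j `|h j x| = sigma x by rewrite /sigma g0 add0r.
rewrite -[leLHS](divfK (_ : n.+1%:R != 0)) ?pnatr_eq0// -/(rho x) mulr_natr.
by rewrite mulrS gerDr leNgt rho0.
Qed.

(** Each [L i] is the complement of two growing unions of open sets. A stage coding [(k, t)] brings
    the intersection over [t] down to content at most [1/(k+1)] in exponent [s + 1/(k+1)]; later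
    stages only shrink it. *)
Lemma small_partitions_sequence n (s : R) (A B : nat -> set X) :
  0 <= s -> small_partitions n s ->
  (forall i, [/\ closed (A i), closed (B i) & A i `&` B i = set0]) ->
  exists L : nat -> set X, (forall i, partition_between (A i) (B i) (L i)) /\
    forall t : seq nat, uniq t -> size t = n ->
      hdim_null s [set x | forall i, i \in t -> L i x].
Proof.
move=> s0 Xs AB.
(* Disjoint closures make the current pairs admissible for the next use of [small_partitions]. *)
pose inv (p : (nat -> set X) * (nat -> set X)) := forall i,
  [/\ open (p.1 i), open (p.2 i) & closure (p.1 i) `&` closure (p.2 i) = set0].
pose step c (p q : (nat -> set X) * (nat -> set X)) :=
  [/\ forall i, p.1 i `<=` q.1 i, forall i, p.2 i `<=` q.2 i &
   forall (k : nat) (t : seq nat), unpickle c = Some (k, t) -> uniq t -> size t = n ->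
     (hausdorff_content (s + k.+1%:R^-1)
       [set x | forall i, i \in t -> ~ (q.1 i `|` q.2 i) x] <= k.+1%:R^-1%:E)%E].
have /choice[p0 p0P] : forall i, exists p0 : set X * set X,
    [/\ open p0.1, open p0.2, A i `<=` p0.1, B i `<=` p0.2 &
        closure p0.1 `&` closure p0.2 = set0].
  move=> i; have [cA cB /disjointP AB0] := AB i.
  have [U [V [oU oV AU BV UV]]] := closed_open_nbhd cA cB.
  exists (U, V); split=> //=.
  - by move=> x Ax; apply: AU; split=> // /(AB0 _ Ax).
  - by move=> x Bx; apply: BV; split=> // /AB0/(_ Bx).
  - by apply/seteqP; split=> // x /UV[/AB0].
have inv0 : inv (fst \o p0, snd \o p0) by move=> i; have [] := p0P i.
have stepP c p : inv p -> exists2 q, inv q & step c p q.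
  move=> invp.
  have [[k [t [ct ut st]]]|nc] := pselect (exists (k : nat) (t : seq nat),
      [/\ unpickle c = Some (k, t), uniq t & size t = n]); last first.
    exists p => //; split=> [i x //|i x //|k t ct ut st].
    by exfalso; apply: nc; exists k, t.
  have k0 : 0 < k.+1%:R^-1 :> R by rewrite invr_gt0.
  pose e (j : 'I_n) := nth 0%N t j.
  have [|L [G [LP oG LG cG]]] := Xs _ k0 (fun j => closure (p.1 (e j)))
      (fun j => closure (p.2 (e j))).
    by move=> j; split; [exact: closed_closure|exact: closed_closure|
      have [] := invp (e j)].
  have [U [V [UVP UVG]]] := thicken_partitions (fun j => @closed_closure _ _)
    (fun j => @closed_closure _ _) LP oG LG.
  have tlt i : i \in t -> (index i t < n)%N by rewrite -st index_mem.
  (* Only the indices in [t] are changed at this stage. *)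
  pose add (W : 'I_n -> set X) i : set X :=
    if insub (index i t) is Some j then W j else set0.
  have addE W j : add W (e j) = W j.
    rewrite /add /e index_uniq ?st//; case: insubP => [j' _ jj'|]; last by rewrite ltn_ord.
    by congr W; apply: val_inj.
  have addN W i : i \notin t -> add W i = set0.
    by rewrite -index_mem st => ni; rewrite /add insubF//; exact: negbTE.
  have eP i : i \in t -> exists j, i = e j.
    by move=> it; exists (Ordinal (tlt i it)); rewrite /e nth_index.
  exists (fun i => p.1 i `|` add U i, fun i => p.2 i `|` add V i).
    move=> i /=; have [op1 op2 p12] := invp i.
    have [/eP[j ij]|nit] := boolP (i \in t); last by rewrite !addN ?setU0.
    rewrite ij !addE; rewrite ij in op1 op2 p12.
    have [oU oV AV UB UV] := UVP j; split; [exact: openU|exact: openU|].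
    by rewrite !closureU setIUl !setIUr p12 AV UB UV !setU0.
  split=> [i x|i x|k' t']; [by left|by left|].
  rewrite ct => -[<- <-] _ _; apply: le_trans cG; apply: hausdorff_contentS.
  move=> x xt; apply: UVG => j _ UVx; apply: (xt (e j)).
    by rewrite mem_nth// st.
  by case: UVx => ?; [left|right]; right; rewrite addE.
have [f f0 fP] := dep_choice inv0 stepP.
have mono i a b : (a <= b)%N -> (f a).1 i `<=` (f b).1 i /\ (f a).2 i `<=` (f b).2 i.
  move=> /subnKC <-; elim: (b - a)%N => [|m [IH1 IH2]]; first by rewrite addn0; split.
  have [_ [S1 S2 _]] := fP (a + m)%N.
  by rewrite addnS; split=> x; [move=> /IH1/S1|move=> /IH2/S2].
exists (fun i => ~` (\bigcup_c (f c).1 i `|` \bigcup_c (f c).2 i)); split.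
  move=> i; exists (\bigcup_c (f c).1 i), (\bigcup_c (f c).2 i).
  have [_ _ Ap Bp _] := p0P i; split=> //.
  - by split; apply: bigcup_open => c _; have [/(_ i)[]] := fP c.
  - by move=> x /Ap ?; exists 0%N => //; rewrite f0.
  - by move=> x /Bp ?; exists 0%N => //; rewrite f0.
  - apply/disjointP => x [a _ xa] [b _ xb].
    have [/(_ i)[_ _ /disjointP disj] _] := fP (maxn a b); apply: (disj x).
      by apply: subset_closure; apply: (mono i _ _ (leq_maxl a b)).1.
    by apply: subset_closure; apply: (mono i _ _ (leq_maxr a b)).2.
move=> t ut st; apply/(hdim_nullP _ s0)/hdim_le => // e e0.
pose k := Num.truncn e^-1.
have k0 : 0 < k.+1%:R^-1 :> R by rewrite invr_gt0.
exists k.+1%:R^-1; split=> //.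
  rewrite -[leRHS]invrK lef_pV2 ?posrE ?invr_gt0//.
  by apply: ltW; exact: truncnS_gt.
have [_ [_ _ /(_ k t (pickleK _) ut st)]] := fP (pickle (k, t)).
apply: le_trans; apply: hausdorff_contentS => x xt i it; have := xt i it.
by apply: contra_not => -[?|?]; [left|right]; exists (pickle (k, t)).+1.
Qed.

End PartitionSequences.
Arguments small_partitions {R} X n s.

(** * Partitions from covers *)

Section GenericLevels.
Context {R : realType}.

(* A vector [a] of the left kernel of the incidence matrix of [S], bordered by
   a row of ones, gives the polynomial [\sum_i a_i 'X^i]. *)
Lemma incidence_poly n l (J : 'I_n -> 'I_l -> bool) (S : {set 'I_l}) :
  (#|S| <= n)%N -> exists2 p : {poly R}, p != 0 &
    forall (t : R) (phi : 'I_l -> R), (forall j, j \notin S -> phi j = 0) ->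
      \sum_j phi j != 0 ->
      (forall i, \sum_(j | J i j) phi j = t ^+ i.+1 * \sum_j phi j) -> root p t.
Proof.
move=> Sn.
pose M : 'M[R]_(n.+1, #|S|) := \matrix_(i, k)
  (if unlift ord0 i is Some i' then (J i' (enum_val k))%:R else 1).
(* There are [n + 1] rows and at most [n] columns. *)
have : kermx M != 0.
  rewrite kermx_eq0 /row_free neq_ltn (leq_ltn_trans (rank_leq_col M))//.
move=> /rowV0Pn[v /sub_kermxP vM v0].
pose p : {poly R} := \poly_(i < n.+1) v 0 (inord i).
exists p.
  apply: contraNneq v0 => p0; apply/eqP/rowP => i; rewrite mxE.
  by have := coef_poly n.+1 (fun i => v 0 (inord i)) i; rewrite -/p p0 coef0
    ltn_ord inord_val.
move=> t phi phiS phi0 phit.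
pose Phi := \sum_j phi j.
(* The row of ones is the case [i = 0], where the level [t^0] times the total is the total
   itself. *)
have levels (i : 'I_n.+1) : t ^+ i * Phi = \sum_k M i k * phi (enum_val k).
  transitivity (\sum_(j in S)
      (if unlift ord0 i is Some i' then (J i' j)%:R else 1) * phi j); last first.
    by rewrite big_enum_val; apply: eq_bigr => k _; rewrite mxE.
  transitivity (\sum_j
      (if unlift ord0 i is Some i' then (J i' j)%:R else 1) * phi j); last first.
    rewrite [RHS]big_mkcond; apply: eq_bigr => j _.
    by case: ifPn => // /phiS ->; rewrite mulr0.
  case: unliftP => [i' ->|->].
    rewrite -phit big_mkcond /=; apply: eq_bigr => j _.
    by case: (J i' j); rewrite ?mul1r ?mul0r.
  by rewrite mul1r; apply: eq_bigr => j _; rewrite mul1r.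
(* Multiplied by [Phi], the value of [p] at [t] becomes the product of [v], [M] and the column of
   the [phi j], which is 0. *)
rewrite /root -(mulIr_eq0 _ (mulIf phi0)) -/Phi horner_poly mulr_suml.
under eq_bigr => i _ do rewrite inord_val -mulrA levels mulr_sumr.
rewrite exchange_big /= big1// => k _.
under eq_bigr => i _ do rewrite mulrA.
rewrite -mulr_suml; have /rowP/(_ k) := vM; rewrite !mxE => ->.
by rewrite mul0r.
Qed.

(** The [size p] distinct points [1/(k+2)] cannot all be roots. *)
Lemma poly_nonroot_unit (p : {poly R}) : p != 0 ->
  exists2 t : R, 0 < t < 1 & ~~ root p t.
Proof.
move=> p0; pose rs := [seq (k.+2%:R^-1 : R) | k <- iota 0 (size p)].
have uniq_rs : uniq rs.
  rewrite map_inj_uniq ?iota_uniq// => a b /invr_inj/eqP.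
  by rewrite eqr_nat => /eqP[].
have [/(max_poly_roots p0)/(_ uniq_rs)|] := boolP (all (root p) rs).
  by rewrite size_map size_iota ltnn.
move=> /allPn[_ /mapP[k _ ->] pk]; exists k.+2%:R^-1 => //.
by rewrite invr_gt0 ltr0n/= invf_lt1 ?ltr1n// ltr0n.
Qed.

(** The polynomial of [S] does not depend on [phi], and there are finitely many [S], so one non-root
    of the product serves them all. *)
Lemma generic_levels n l (J : 'I_n -> 'I_l -> bool) :
  exists2 t : R, 0 < t < 1 & forall (S : {set 'I_l}) (phi : 'I_l -> R),
    (#|S| <= n)%N -> (forall j, j \notin S -> phi j = 0) -> \sum_j phi j != 0 ->
    ~ (forall i, \sum_(j | J i j) phi j = t ^+ i.+1 * \sum_j phi j).
Proof.
have /choice[p pP] : forall S : {set 'I_l}, exists p : {poly R}, p != 0 /\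
    ((#|S| <= n)%N -> forall (t : R) (phi : 'I_l -> R),
      (forall j, j \notin S -> phi j = 0) -> \sum_j phi j != 0 ->
      (forall i, \sum_(j | J i j) phi j = t ^+ i.+1 * \sum_j phi j) -> root p t).
  move=> S; have [Sn|nSn] := boolP (#|S| <= n)%N; last first.
    by exists 1; split; [exact: oner_neq0|].
  by have [p p0 pP] := incidence_poly J Sn; exists p.
have [|t t01 pt] := @poly_nonroot_unit (\prod_S p S).
  by apply/prodf_neq0 => S _; have [] := pP S.
exists t => // S phi Sn phiS phi0 phit; move/negP: pt; apply.
rewrite rootE horner_prod; apply/prodf_eq0; exists S => //.
by have [_ /(_ Sn t phi phiS phi0 phit)] := pP S.
Qed.

End GenericLevels.

Section CoverPartitions.
Context {R : realType} {X : metricType R}.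

(** With [phi j] the distance to the complement of [V j], the partition of index [i] is the level
    set [g i = t^(i+1) Phi], where [g i] sums the [phi j] over the [V j] missing [B i]. Thus [g i]
    is [Phi] on [A i] and 0 on [B i]. At a point in at most [n] members, all the equations together
    contradict the choice of [t]. *)
Lemma cover_partitions n l (V : 'I_l -> set X) (A B : 'I_n -> set X) :
  open_cover V -> (forall i j, V j `&` A i = set0 \/ V j `&` B i = set0) ->
  exists L : 'I_n -> set X, (forall i, partition_between (A i) (B i) (L i)) /\
    \bigcap_i L i `<=` covered_at_least n.+1 V.
Proof.
move=> [oV covV] VAB.
pose phi j := tdist (~` V j).
have phiN j x : ~ V j x -> phi j x = 0.
  by move=> nV; apply/tdist_eq0; exact: subset_closure.
have phiV j x : V j x -> 0 < phi j x.
  by move=> Vx; apply/tdist_gt0; [exact: open_closedC|exact].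
have phi_ge0 j x : 0 <= phi j x by exact: tdist_ge0.
pose Phi x := \sum_j phi j x.
have Phi0 x : 0 < Phi x.
  have [j _ Vx] : cover [set: 'I_l] V x by rewrite covV.
  by rewrite /Phi (bigD1 j)//= ltr_pwDl ?phiV// sumr_ge0.
pose J i j := `[< V j `&` B i = set0 >].
have [t /andP[t0 t1] tP] := generic_levels (R := R) J.
pose c (i : 'I_n) := t ^+ i.+1.
have c0 i : 0 < c i by rewrite exprn_gt0.
have c1 i : c i < 1 by rewrite exprn_ilt1// ltW.
pose g i x := \sum_(j | J i j) phi j x.
have cphi j : continuous (phi j) by exact: tdist_continuous.
have cg i : continuous (g i).
  by apply: continuous_big => [|j _]; [exact: add_continuous|exact: cphi].
have cPhi i : continuous (fun x => c i * Phi x).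
  move=> x; apply: cvgM; first exact: cvg_cst.
  by move: x; apply: continuous_big => [|j _]; [exact: add_continuous|exact: cphi].
exists (fun i => ~` ([set x | c i * Phi x < g i x] `|` [set x | g i x < c i * Phi x])).
split.
  move=> i; exists [set x | c i * Phi x < g i x], [set x | g i x < c i * Phi x].
  split=> //.
  - split; exact: continuous_open_lt.
  - move=> x Ax /=; have -> : g i x = Phi x.
      rewrite /g big_mkcond; apply: eq_bigr => j _; case: ifPn => // /asboolPn nJ.
      rewrite phiN// => Vx; have [/disjointP/(_ x Vx Ax)|//] := VAB i j.
      exact.
    by rewrite gtr_pMl// c1.
  - move=> x Bx /=; rewrite /g big1 ?mulr_gt0// => j /asboolP/disjointP Jj.
    by rewrite phiN// => /Jj/(_ Bx).
  - by apply/disjointP => x /= /ltW; rewrite leNgt => /negP.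
move=> x Lx; rewrite /covered_at_least/= ltnNge; apply/negP => Vn.
pose S := [set j | x \in V j]%SET.
apply: (tP S (fun j => phi j x)).
- by rewrite cardsE.
- by move=> j; rewrite inE => /negP nV; apply: phiN => Vx; apply: nV; rewrite inE.
- exact: lt0r_neq0 (Phi0 x).
- move=> i; apply/eqP; rewrite eq_le -/(c i) -/(Phi x) -/(g i x).
  by apply/andP; split; rewrite leNgt; apply/negP => h; apply: (Lx i I); [left|right].
Qed.

End CoverPartitions.

(** * The characterizations *)

Section Characterizations.
Context {R : realType} {X : metricType R}.
Implicit Types (A B E G L U V W : set X) (I : set (set X)).

(** A pair is the closure of a ball of half radius and the complement of the full ball, so any [U i]
    between them is caught between two balls. The extra code [r] repeats each pair infinitely often,
    which allows avoiding [N]. *)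
Lemma base_pairs : separable X -> X -> exists A B : nat -> set X,
  (forall i, [/\ closed (A i), closed (B i) & A i `&` B i = set0]) /\
  forall U : nat -> set X, (forall i, A i `<=` U i /\ U i `<=` ~` B i) ->
    forall (N : seq nat) x W, open W -> W x ->
      exists i, [/\ i \notin N, U i x & U i `<=` W].
Proof.
move=> sX x0; have [d dd] := separable_dense_seq sX x0.
pose P (C : nat -> nat -> set X) c :=
  if @unpickle (nat * nat * nat)%type c is Some (k, m, _) then C k m else set0.
pose a k m := closure [set y | mdist (d k) y < m.+1%:R^-1 / 2].
pose b k m := ~` [set y | mdist (d k) y < m.+1%:R^-1].
exists (P a), (P b); split.
  move=> c; rewrite /P; case: unpickle => [[[k m] _]|]; last first.
    by split; [exact: closed0|exact: closed0|rewrite set0I].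
  split; [exact: closed_closure|exact/open_closedC/open_mdist_lt|].
  apply/disjointP => y ay; apply => /=.
  have r0 : 0 < m.+1%:R^-1 / 2 :> R by rewrite divr_gt0// invr_gt0.
  have [z [/= kz yz]] := ay _ (nbhs_mdist y r0).
  rewrite [ltRHS]splitr; apply: le_lt_trans (metric_triangle _ z _) _.
  by rewrite ltrD// metric_sym.
move=> U UP N x W oW Wx.
have [k [m [kx kmW]]] := dense_seq_base dd oW Wx.
pose c (r : nat) : nat := pickle (k, m, r).
have [r rN] : exists r, c r \notin N.
  apply: contrapT => nr.
  have cN : {subset [seq c r | r <- iota 0 (size N).+1] <= N}.
    by move=> _ /mapP[r _ ->]; apply: contrapT => /negP rN; apply: nr; exists r.
  have := uniq_leq_size _ cN; rewrite size_map size_iota ltnn.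
  move=> /(_ _)/notF; apply.
  by rewrite map_inj_uniq ?iota_uniq// => r r' /(pcan_inj pickleK)[].
exists (c r); have [] := UP (c r); rewrite /P /c pickleK => aU Ub; split=> //.
  by apply: aU; exact: subset_closure.
by move=> y /Ub /contrapT /kmW.
Qed.

(* The part of [E] on [L i] is handled by the sequences avoiding [i]; this is
   why every pair is repeated infinitely often in [base_pairs]. *)
Lemma dim_over_partition_seq I (U V : nat -> set X) k E (N : seq nat) :
  (forall A B, A `<=` B -> I B -> I A) ->
  (forall i, [/\ open (U i), open (V i) & U i `&` V i = set0]) ->
  (forall (N : seq nat) x W, open W -> W x ->
    exists i, [/\ i \notin N, U i x & U i `<=` W]) ->
  uniq N ->
  (forall t : seq nat, uniq (t ++ N) -> size t = k ->
     I (E `&` [set x | forall i, i \in t -> ~ (U i `|` V i) x])) ->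
  dim_over I k E.
Proof.
move=> IS UV base; elim: k E N => [|k IH] E N uN EN.
  by apply: IS (EN [::] uN erefl) => x Ex.
exists [set E `&` U i | i in [set i | i \notin N]].
  split=> [_ [i _ <-]|x W Ex oW Wx]; first by exists (U i) => //; have [] := UV i.
  have [i [iN Ux UW]] := base N x W oW Wx.
  by exists (E `&` U i); split=> //; [exists i|move=> y [_ /UW]].
move=> _ [i /= iN <-]; apply: (IH _ (i :: N)); first by rewrite /= iN.
move=> t; rewrite -cat_rcons => ut st.
have {ut} ut : uniq ((i :: t) ++ N).
  by rewrite -(@perm_uniq _ (rcons t i ++ N))// perm_cat2r perm_rcons.
apply: IS (EN (i :: t) ut (congr1 S st)) => x [[[Ex xU] xEU] xt]; split=> // j.
rewrite inE => /orP[/eqP -> {j}|]; last exact: xt.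
(* A boundary point in [U i] would have a neighbourhood missing the rest of [E], one in [V i] a
   neighbourhood missing [U i]. *)
have [oU oV /disjointP UVi] := UV i; case=> [Ux|Vx].
  by apply: notin_closure oU Ux _ xEU => y Uy [Ey nEU]; apply: nEU.
by apply: notin_closure oV Vx _ xU => y Vy [_ /UVi/(_ Vy)].
Qed.

Lemma small_partitions_base n (s : R) : separable X -> X -> 0 <= s ->
  small_partitions X n s ->
  exists U V : nat -> set X,
    [/\ forall i, [/\ open (U i), open (V i) & U i `&` V i = set0],
     forall (N : seq nat) x W, open W -> W x ->
       exists i, [/\ i \notin N, U i x & U i `<=` W] &
     forall t : seq nat, uniq t -> size t = n ->
       hdim_null s [set x | forall i, i \in t -> ~ (U i `|` V i) x]].
Proof.
move=> sX x0 s0 Xs; have [A [B [AB base]]] := base_pairs sX x0.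
have [L [LP Ls]] := small_partitions_sequence s0 Xs AB.
have /choice[UV UVP] : forall i, exists UV : set X * set X,
    [/\ open UV.1 /\ open UV.2, A i `<=` UV.1, B i `<=` UV.2,
        UV.1 `&` UV.2 = set0 & L i = ~` (UV.1 `|` UV.2)].
  by move=> i; have [U [V UVi]] := LP i; exists (U, V).
exists (fst \o UV), (snd \o UV); split=> /=.
- by move=> i; have [[]] := UVP i.
- apply: base => i; have [_ AU BV /disjointP UVi _] := UVP i; split=> //.
  by move=> x Ux /BV; exact: UVi.
- move=> t ut st; apply: hdim_nullS (Ls t ut st) => x xt i it.
  by have [_ _ _ _ ->] := UVP i; exact: xt.
Qed.

Lemma small_partitions_dim_over n (s : R) : separable X -> X -> 0 <= s ->
  small_partitions X n s -> dim_over (hdim_null s) n [set: X].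
Proof.
move=> sX x0 s0 Xs; have [U [V [UV base UVs]]] := small_partitions_base sX x0 s0 Xs.
apply: (@dim_over_partition_seq _ U V n setT [::]) => //.
  by move=> A B; exact: hdim_nullS.
by move=> t; rewrite cats0 setTI; exact: UVs.
Qed.

(** [A] is the countable union, over lists of [n] distinct indices, of the intersections of the
    corresponding partitions. Off [A] any [n] of them have empty intersection, so the ideal reduces
    to the empty set. *)
Lemma small_partitions_split n (s : R) : separable X -> X -> 0 <= s ->
  small_partitions X n s -> exists2 A : set X, hdim_null s A & tdim_lt n (~` A).
Proof.
move=> sX x0 s0 Xs; have [U [V [UV base UVs]]] := small_partitions_base sX x0 s0 Xs.
pose C (t : seq nat) := [set x | forall i : nat, i \in t -> ~ (U i `|` V i) x].
pose F c := if @unpickle (seq nat) c is Some t then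
  if uniq t && (size t == n) then C t else set0 else set0.
have s00 : hdim_null s (set0 : set X).
  by move=> t _; exact: hausdorff_content_set0.
exists (\bigcup_c F c).
  apply: hdim_null_bigcup => c; rewrite /F; case: unpickle => // t.
  by case: ifP => // /andP[ut /eqP st]; exact: UVs.
apply/tdim_lt_dim_over/(@dim_over_partition_seq _ U V n _ [::]) => //.
  by move=> A B AB B0; apply/seteqP; split=> // x /AB; rewrite B0.
move=> t; rewrite cats0 => ut st; apply/seteqP; split=> // x [nF xt]; apply: nF.
by exists (pickle t) => //; rewrite /F pickleK ut st eqxx.
Qed.

(** Take an open [G] of small content around [A]. The complement of [A] lies in [n] zero-dimensional
    sets, each covered by a disjoint open family refining [U]; the traces of [U] on [G] complete the
    cover. A point outside [G] is in at most one member of each family. *)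
Lemma null_split_cover n (s e : R) A k (U : 'I_k -> set X) :
  (0 < n)%N -> separable X -> 0 <= s -> 0 < e ->
  hdim_null s A -> tdim_lt n (~` A) -> open_cover U ->
  exists l (V : 'I_l -> set X), [/\ open_cover V, refines V U &
    (hausdorff_content (s + e) (covered_at_least n.+1 V) <= e%:E)%E].
Proof.
case: n => // n _ sX s0 e0 As An [oU covU].
have se0 : 0 < s + e by rewrite ltr_wpDl.
have [G [oG AG Ge]] := hausdorff_content_open_hull se0 e0
  (As (s + e) (ltac:(by rewrite ltrDl))).
have sI : sigma_stable [set (set0 : set X)].
  by split=> // F F0; apply/seteqP; split=> // x [i _]; rewrite F0.
have [J [Z [J0 zZ AZ]]] := dim_over_decomp sX sI ((tdim_lt_dim_over _ _).1 An).
pose U' i := if insub i is Some j then U j else set0.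
have U'E (j : 'I_k) : U' j = U j.
  by rewrite /U' insubT//; move=> jk; congr U; exact: val_inj.
have /choice[D DP] : forall j, exists D : nat -> set X,
    [/\ forall i, open (D i), forall i, D i `<=` U' i, trivIset setT D &
        Z j `<=` \bigcup_(i in `I_k) D i].
  move=> j; apply: zdim_disjoint_refinement => //.
    by move=> i; rewrite /U'; case: insub => // ; exact: open0.
  move=> x _; have : cover [set: 'I_k] U x by rewrite covU.
  by move=> [i _ Ux]; exists i => /=; rewrite ?U'E.
pose T : finType := ('I_n.+1 * 'I_k + 'I_k)%type.
pose W (c : T) := match c with inl p => D p.1 p.2 | inr i => G `&` U i end.
exists #|T|, (fun c => W (enum_val c)); split.
- split.
    move=> c; rewrite /W; case: (enum_val c) => [p|i].
      by have [] := DP p.1.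
    exact: openI.
  apply/seteqP; split=> // x _.
  suff [c Wx] : exists c, W c x by exists (enum_rank c); rewrite ?enum_rankK.
  have [Gx|nG] := pselect (G x).
    have [i _ Ux] : cover [set: 'I_k] U x by rewrite covU.
    by exists (inr i).
  have [|[j /= jn Zx]] := AZ x (fun Ax => nG (AG x Ax)); first by rewrite J0.
  have [_ _ _ /(_ x Zx)[i /= ik Dx]] := DP j.
  by exists (inl (Ordinal jn, Ordinal ik)).
- move=> c; rewrite /W; case: (enum_val c) => [p|i]; last by exists i => x [].
  by exists p.2; have [_ /(_ p.2)] := DP p.1; rewrite U'E.
apply: le_trans Ge; apply: hausdorff_contentS => x /=.
rewrite /covered_at_least/= ltnNge => /negP xV; apply: contrapT => nG; apply: xV.
(* The index of the family, injective on the members containing [x]; the default [ord0] concerns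
   traces on [G], which omit [x]. *)
pose f (c : 'I_#|T|) : 'I_n.+1 := if enum_val c is inl p then p.1 else ord0.
rewrite -[leqRHS]card_ord; apply: (@leq_card_in _ _ f) => c c'.
rewrite !inE /f => Wc Wc' ff; apply: enum_val_inj; move: Wc Wc' ff.
case: (enum_val c) => [[j i]|i]; last by move=> [Gx]; case: (nG Gx).
case: (enum_val c') => [[j' i']|i']; last by move=> _ [Gx]; case: (nG Gx).
move=> /= Dx Dx' jj'; rewrite -jj' in Dx' *.
have [_ _ /trivIsetP tD _] := DP j.
congr (inl (_, _)); apply/val_inj/eqP; apply: contrapT => /negP ii'.
by have /disjointP/(_ x Dx Dx') := tD i i' I I ii'.
Qed.

(** * From dimension bounds, splittings and covers back to small partitions *)

Lemma null_small_partitions n (s : R) : 0 <= s ->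
  (forall (e : R) (A B : 'I_n -> set X), 0 < e ->
    (forall i, [/\ closed (A i), closed (B i) & A i `&` B i = set0]) ->
    exists L : 'I_n -> set X, (forall i, partition_between (A i) (B i) (L i)) /\
      (hausdorff_content (s + e) (\bigcap_i L i) = 0)%E) ->
  small_partitions X n s.
Proof.
move=> s0 h e e0 A B AB; have [L [LP L0]] := h e A B e0 AB.
have se0 : 0 < s + e by rewrite ltr_wpDl.
have [G [oG LG Ge]] := hausdorff_content_open_hull se0 e0 L0.
by exists L, G.
Qed.

Lemma thdim_small_partitions n (s : R) : separable X -> 0 <= s ->
  (thdim n [set: X] <= (s + n%:R)%:E)%E -> small_partitions X n s.
Proof.
move=> sX s0 Xs; apply: null_small_partitions => // e A B e0 AB.
have se0 : 0 < s + e by rewrite ltr_wpDl.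
have Xse : (thdim n [set: X] < (s + e + n%:R)%:E)%E.
  by apply: le_lt_trans Xs _; rewrite lte_fin addrAC ltrDl.
have sI : sigma_stable [set B : set X | hausdorff_content (s + e) B = 0%E].
  by split; [exact: hausdorff_content_set0|exact: hausdorff_content0_bigcup].
have [L [LP [J J0 LJ]]] := dim_over_partitions sX sI (dim_over_thdim se0 Xse) AB.
by exists L; split=> //; apply: hausdorff_content0S J0; rewrite setTI in LJ.
Qed.

Lemma split_small_partitions n (s : R) A : separable X -> 0 <= s ->
  hdim_null s A -> tdim_lt n (~` A) -> small_partitions X n s.
Proof.
move=> sX s0 As An; apply: null_small_partitions => // e B C e0 BC.
have sI : sigma_stable [set (set0 : set X)].
  by split=> // F F0; apply/seteqP; split=> // x [i _]; rewrite F0.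
have [L [LP [J J0 LJ]]] := dim_over_partitions sX sI ((tdim_lt_dim_over _ _).1 An) BC.
exists L; split=> //; apply: hausdorff_content0S (As (s + e) _); last by rewrite ltrDl.
by move=> x Lx; apply: contrapT => nA; have := LJ x (conj nA Lx); rewrite J0.
Qed.

Lemma cover_small_partitions n (s : R) :
  (forall (e : R) k (U : 'I_k -> set X), 0 < e -> open_cover U ->
    exists l (V : 'I_l -> set X), [/\ open_cover V, refines V U &
      (hausdorff_content (s + e) (covered_at_least n.+1 V) <= e%:E)%E]) ->
  small_partitions X n s.
Proof.
move=> h e e0 A B AB.
(* For each [i], every member of the cover [U] misses [A i] or [B i], as its index [T] prescribes;
   refinements inherit this. *)
pose C (T : {set 'I_n}) i := if i \in T then A i else B i.
pose U (c : 'I_#|{set 'I_n}|) := ~` \bigcup_i C (enum_val c) i.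
have oC : open_cover U.
  split.
    move=> c; apply: closed_openC.
    apply: closed_bigcup => [|i _]; first exact: finite_finset.
    by rewrite /C; have [cA cB _] := AB i; case: ifP.
  apply/seteqP; split=> // x _.
  (* Let [T] collect the [i] with [x] in [B i]; by disjointness [x] is then off [A i]. *)
  exists (enum_rank [set i | `[< B i x >]]%SET) => //; rewrite /U enum_rankK => -[i _].
  rewrite /C inE; case: asboolP => // Bx Ax.
  by have [_ _ /disjointP/(_ x Ax Bx)] := AB i.
have [l [V [cV VU Ve]]] := h e _ U e0 oC.
have [|L [LP LV]] := @cover_partitions _ _ n l V A B cV.
  move=> i j; have [c Vc] := VU j.
  have [ic|ic] := boolP (i \in enum_val c); [left|right].
    by apply/disjointP => x /Vc nC Ax; apply: nC; exists i; rewrite // /C ic.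
  by apply/disjointP => x /Vc nC Bx; apply: nC; exists i; rewrite // /C (negbTE ic).
exists L, (covered_at_least n.+1 V); split=> //.
(* The set serves as its own open hull, being a finite union of finite intersections of the
   [V j]. *)
rewrite (_ : covered_at_least n.+1 V =
    \bigcup_(S in [set S : {set 'I_l} | (n.+1 <= #|S|)%N])
      ~` \bigcup_(j in [set j | j \in S]) ~` V j).
  apply: bigcup_open => S _; apply: closed_openC.
  apply: closed_bigcup => [|j _]; first exact: finite_finset.
  by apply: open_closedC; have [] := cV.
apply/seteqP; split=> [x xV|x [S /= Sn xS]].
  exists [set j | x \in V j]%SET; first by rewrite /= cardsE.
  by move=> [j /=]; rewrite !inE.
rewrite /covered_at_least/=; apply: leq_trans Sn _; apply: subset_leq_card.
apply/fintype.subsetP => j jS; rewrite !inE; apply: contrapT => nV.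
by apply: xS; exists j.
Qed.

End Characterizations.

(** * The dimension as common least element of the four sets *)

Local Open Scope ereal_scope.

Theorem theorem4p4 (R : realType) (X : metricType R) (n : nat) :
  (0 < n)%N ->
  separable X ->
  n%:R%:E <= tdim (R := R) [set: X] ->
  [/\ is_minimum (P_t X n) (thdim n [set: X]),
      is_minimum (P_d X n) (thdim n [set: X]),
      is_minimum (P_p X n) (thdim n [set: X]) &
      is_minimum (P_c X n) (thdim n [set: X])].
Proof.
case: n => // m m0 sX; set n := m.+1 in m0 * => nX.
have tdimP (A : set X) : tdim_lt n A <-> tdim (R := R) A <= n%:R%:E - 1.
  split=> [An|An]; first by apply: ereal_inf_lbound; exists n.
  have : tdim (R := R) A < n%:R%:E.
    by apply: le_lt_trans An _; rewrite -EFinB lte_fin gtrBl.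
  move=> /ereal_inf_lt[_ [k /= Ak <-]]; rewrite lte_fin ltrBlDr natr1 ltr_nat ltnS.
  by move=> kn; exact: tdim_lt_leq kn Ak.
have [x0 _] : [set: X] !=set0.
  apply/set0P/eqP => X0; move: nX; rewrite X0 tdim_set0 leNgt => /negP; apply.
  by rewrite (lt_le_trans lteN10)// lee_fin.
have nD : n%:R%:E <= thdim n [set: X].
  rewrite leNgt; apply/negP => /thdim_lt_tdim_lt/tdimP/(le_trans nX).
  by rewrite -EFinB lee_fin lerBrDr gerDl ler10.
have real_or_oo (d : \bar R) : n%:R%:E <= d ->
    d = +oo \/ exists2 s : R, (0 <= s)%R & d = (s + n%:R)%:E.
  case: d => [r| |] //; last by left.
  by rewrite lee_fin => nr; right; exists (r - n%:R)%R; rewrite ?subr_ge0 ?subrK.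
have subn (s : R) : (s + n%:R)%:E - n%:R%:E = s%:E by rewrite -EFinB addrK.
have lower s : (0 <= s)%R -> small_partitions X n s ->
    thdim n [set: X] <= (s + n%:R)%:E.
  by move=> s0 Xs; apply: (thdim_dim_over s0); exact: small_partitions_dim_over.
have mem s : (0 <= s)%R -> small_partitions X n s ->
    [/\ P_t X n (s + n%:R)%:E, P_d X n (s + n%:R)%:E,
        P_p X n (s + n%:R)%:E & P_c X n (s + n%:R)%:E].
  move=> s0 Xs; have ns : n%:R%:E <= (s + n%:R)%:E by rewrite lee_fin lerDr.
  have [A As An] := small_partitions_split sX x0 s0 Xs.
  split; right.
  - have [BB bBB BBm] := small_partitions_dim_over sX x0 s0 Xs.
    exists BB => // U /BBm/(thdim_dim_over s0); rewrite /= -EFinB.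
    by rewrite /n -natr1 addrA addrK.
  - split=> //; exists A; split; last exact/tdimP.
    by rewrite subn; apply/hdim_nullP.
  - split=> // A0 B0 AB0.
    (* The [n] pairs are padded with empty ones to a sequence, of which only the first [n]
       partitions are used. *)
    pose ext (C : 'I_n -> set X) i := if insub i is Some j then C j else set0.
    have extE C (j : 'I_n) : ext C j = C j.
      by rewrite /ext insubT//; move=> jn; congr C; exact: val_inj.
    have [|L [LP Ls]] := @small_partitions_sequence _ _ n s (ext A0) (ext B0) s0 Xs.
      move=> i; rewrite /ext; case: insubP => // _.
      by split; [exact: closed0|exact: closed0|exact: set0I].
    exists (fun j => L j); split.
      by move=> j; have := LP j; rewrite !extE.
    rewrite subn; apply/(hdim_nullP _ s0).
    apply: hdim_nullS (Ls (iota 0 n) (iota_uniq _ _) (size_iota _ _)) => x Lx i.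
    by rewrite mem_iota => /andP[_ ni]; exact: (Lx (Ordinal ni)).
  - exists (s + n%:R)%R; split=> // e k U e0 cU; rewrite addrK.
    exact: null_split_cover s0 e0 As An cU.
(* The margin [e] in [small_partitions] makes it hold at the exact value of the dimension, so the
   minima are attained. *)
have small s : (0 <= s)%R -> thdim n [set: X] = (s + n%:R)%:E ->
    small_partitions X n s.
  by move=> s0 Ds; apply: thdim_small_partitions => //; rewrite Ds.
have attained : [/\ P_t X n (thdim n [set: X]), P_d X n (thdim n [set: X]),
    P_p X n (thdim n [set: X]) & P_c X n (thdim n [set: X])].
  have [->|[s s0 Ds]] := real_or_oo _ nD; first by split; left.
  by rewrite Ds; apply: mem => //; exact: small.
have [Dt Dd Dp Dc] := attained.
split; split=> // d.
- move=> [->|[BB bBB BBd]]; first exact: leey.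
  rewrite /n /=; case: asboolP => [X0|_]; last by apply: ereal_inf_lbound; exists BB.
  by have : (set0 : set X) x0 by rewrite -X0.
- move=> [->|[nd [A [Ad An]]]]; first exact: leey.
  have [->|[s s0 ds]] := real_or_oo _ nd; first exact: leey.
  rewrite ds; apply: lower => //; apply: (@split_small_partitions _ _ _ _ A) => //.
    by apply/hdim_nullP => //; rewrite -subn -ds.
  exact/tdimP.
- move=> [->|[nd Lpd]]; first exact: leey.
  have [->|[s s0 ds]] := real_or_oo _ nd; first exact: leey.
  rewrite ds; apply: lower => //; apply: null_small_partitions => // e A B e0 AB.
  have [L [LP Ld]] := Lpd A B AB; exists L; split=> //.
  by apply: ((hdim_nullP _ s0).1 _); rewrite ?ltrDl// -subn -ds.
- move=> [->|[r [-> nr Vr]]]; first exact: leey.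
  rewrite -[r](subrK n%:R); apply: lower; first by rewrite subr_ge0.
  by apply: cover_small_partitions => e k U; exact: Vr.
Qed.
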